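(* Let $G$ be a connected graph whose discrete fundamental group $\pi_1(G,v_0)$ (for some vertex $v_0$) is cyclic, and fix an integer $r\geq 2$. Suppose $\phi:G\to H$ is a graph homomorphism such that $H$ is $C_{2r+1}$-free, and suppose further that some odd cycle $C$ of $G$ satisfies $|\phi(V(C))|\leq 2r+2$. Then $\chi(G)<8r^2$.
   Context: A walk of length $k$ is a sequence $v_0\cdots v_k$ of vertices with consecutive vertices adjacent. Two walks are homotopic if one can be transformed into the other by finitely many steps: (Sub) replace an interior vertex $v_i$ ($0<i<k$) by any common neighbor of $v_{i-1}$ and $v_{i+1}$; (Ins) replace some $v_i$ by $v_iwv_i$ for a neighbor $w$ of $v_i$; (Del) for $0<i<k$ with $v_{i-1}=v_{i+1}$, replace $v_{i-1}v_iv_{i+1}$ by $v_{i-1}$. The discrete fundamental group $\pi_1(G,v_0)$ is the group of homotopy classes of closed walks starting and ending at $v_0$ under concatenation. $C_k$ is the cycle of length $k$; $C_k$-free means no subgraph isomorphic to $C_k$. *)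

(* Defs.v *)
From HB Require Import structures.
From Stdlib Require Import Relation_Operators.
From mathcomp Require Import all_boot.
From mathcomp Require Import boolp.

Set Implicit Arguments.
Unset Strict Implicit.
Unset Printing Implicit Defensive.

Record sgraph := SGraph {
  vertex :> finType;
  adj : rel vertex;
  adj_sym : symmetric adj;
  adj_irrefl : irreflexive adj
}.

Definition connected (G : sgraph) : Prop :=
  forall x y : G, connect (@adj G) x y.

Definition graph_hom (G H : sgraph) (phi : G -> H) : Prop :=
  {homo phi : x y / adj x y}.

(** A cycle is given by its vertices listed in cyclic order, each once; the
    bound on the size excludes the traversal of a single edge back and forth. *)
Definition is_cycle (G : sgraph) (c : seq G) : Prop :=
  ucycle (@adj G) c /\ 2 < size c.

Definition cycle_free (k : nat) (G : sgraph) : Prop :=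
  forall c : seq G, is_cycle c -> size c <> k.

Definition colorable (G : sgraph) (k : nat) : bool :=
  [exists f : {ffun G -> 'I_k},
    [forall x, [forall y, adj x y ==> (f x != f y)]]].

Lemma colorable_card (G : sgraph) : exists k, colorable G k.
Proof.
exists #|G|; apply/existsP; exists [ffun x => enum_rank x].
apply/forallP=> x; apply/forallP=> y; apply/implyP=> xy; rewrite !ffunE.
by apply: contraTneq xy => /enum_rank_inj->; rewrite adj_irrefl.
Qed.

Definition chromatic_number (G : sgraph) : nat := ex_minn (colorable_card G).

(** A walk [v_0 ... v_k] is the list of its [k.+1] vertices,
    i.e. a nonempty list satisfying [sorted adj]. The steps below are stated on
    arbitrary lists; each of them sends walks to walks. *)

Section Homotopy.
Variable G : sgraph.
Implicit Types (s t u : seq G) (a b v w x y : G).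

Inductive hstep : seq G -> seq G -> Prop :=
| Sub s1 s2 a x b y : adj a y -> adj y b ->
    hstep (s1 ++ [:: a, x, b & s2]) (s1 ++ [:: a, y, b & s2])
| Ins s1 s2 x w : adj x w ->
    hstep (s1 ++ x :: s2) (s1 ++ [:: x, w, x & s2])
| Del s1 s2 x w :
    hstep (s1 ++ [:: x, w, x & s2]) (s1 ++ x :: s2).

Definition homotopic : seq G -> seq G -> Prop := clos_refl_trans _ hstep.

Lemma homotopic_map (f : seq G -> seq G) :
    (forall s t, hstep s t -> hstep (f s) (f t)) ->
  forall s t, homotopic s t -> homotopic (f s) (f t).
Proof.
move=> fP s t; elim=> [s1 t1 /fP|s1|s1 s2 s3 _ IH1 _ IH2]; first exact: rt_step.
  exact: rt_refl.
exact: rt_trans IH1 IH2.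
Qed.

Lemma homotopic_catl u s t : homotopic s t -> homotopic (u ++ s) (u ++ t).
Proof.
by apply: (@homotopic_map (cat u)) => _ _ [] *; rewrite !catA; constructor.
Qed.

Lemma homotopic_catr u s t : homotopic s t -> homotopic (s ++ u) (t ++ u).
Proof.
by apply: (@homotopic_map (cat^~ u)) => _ _ [] *; rewrite /= -!catA /=; constructor.
Qed.

Lemma homotopic_rev s t : homotopic s t -> homotopic (rev s) (rev t).
Proof.
apply: (@homotopic_map rev) => _ _ [s1 s2 a x b y ay yb|s1 s2 x w xw|s1 s2 x w];
  rewrite !rev_cat !rev_cons -!cats1 -!catA /=; constructor=> //;
  by rewrite adj_sym.
Qed.

Lemma sorted_cat_cons s1 x s2 :
  sorted (@adj G) (s1 ++ x :: s2)
    = sorted (@adj G) (rcons s1 x) && path (@adj G) x s2.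
Proof. by case: s1 => //= z s1; rewrite cat_path rcons_path /= andbA. Qed.

Lemma hstep_walk s t : sorted (@adj G) s -> hstep s t ->
  sorted (@adj G) t /\ homotopic t s.
Proof.
move=> + st; case: st => [s1 s2 a x b y ay yb|s1 s2 x w xw|s1 s2 x w];
  rewrite !sorted_cat_cons /=.
- case/and4P=> s1a ax xb bs2; rewrite s1a ay yb bs2; split=> //.
  exact/rt_step/Sub.
- case/andP=> s1x xs2; rewrite s1x xw adj_sym xw xs2; split=> //.
  exact/rt_step/Del.
- case/and4P=> s1x xw _ xs2; rewrite s1x xs2; split=> //.
  exact/rt_step/Ins.
Qed.

Lemma homotopic_sym s t : sorted (@adj G) s -> homotopic s t -> homotopic t s.
Proof.
move=> sG st; suff [] : sorted (@adj G) t /\ homotopic t s by [].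
elim: st sG => {s t} [s t st sG|s sG|s t u _ IHs _ IHt sG].
- exact: hstep_walk st.
- by split=> //; apply: rt_refl.
- have [tG ts] := IHs sG; have [uG ut] := IHt tG.
  by split=> //; apply: rt_trans ut ts.
Qed.

Lemma homotopic_catV x p :
  homotopic ((x :: p) ++ behead (rev (x :: p))) [:: x].
Proof.
elim/last_ind: p => [|p y IHp]; first exact: rt_refl.
apply: rt_trans IHp; rewrite -rcons_cons rev_rcons /=.
case: (lastP p) => [|q z] /=.
  by apply: rt_step; apply: (@Del [::] [::]).
rewrite !rev_cons !rev_rcons -!cats1 /= -!catA /= -!cat_cons.
exact/rt_step/Del.
Qed.

End Homotopy.

Section FundamentalGroup.
Variables (G : sgraph) (v0 : G).

Definition closed_walk_at (s : seq G) : bool :=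
  if s is x :: p then [&& x == v0, path (@adj G) x p & last x p == v0]
  else false.

Record loop := Loop { loop_walk :> seq G; _ : closed_walk_at loop_walk }.
HB.instance Definition _ := [isSub for loop_walk].
HB.instance Definition _ := [Choice of loop by <:].

Lemma loop_consP (p : loop) : {s | loop_walk p = v0 :: s &
  path (@adj G) v0 s /\ last v0 s = v0}.
Proof.
case: p => [[|x s] //= /and3P[/eqP-> ? /eqP]]; by exists s.
Qed.

Lemma loop_rconsP (p : loop) : {s | loop_walk p = rcons s v0}.
Proof.
have [s -> [_ sv0]] := loop_consP p.
by exists (belast v0 s); rewrite lastI sv0.
Qed.

Lemma loop_sorted (p : loop) : sorted (@adj G) p.
Proof. by have [s -> []] := loop_consP p. Qed.

Lemma loop_one_subproof : closed_walk_at [:: v0].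
Proof. by rewrite /= eqxx. Qed.
Definition loop_one := Loop loop_one_subproof.

(* [behead] avoids repeating [v0], which ends [p] and begins [q]. *)
Lemma loop_mul_subproof (p q : loop) : closed_walk_at (p ++ behead q).
Proof.
have [s -> [sG sv0]] := loop_consP p; have [t -> [tG tv0]] := loop_consP q.
by rewrite /= eqxx cat_path last_cat sv0 sG tG tv0 eqxx.
Qed.
Definition loop_mul (p q : loop) := Loop (loop_mul_subproof p q).

Lemma loop_inv_subproof (p : loop) : closed_walk_at (rev p).
Proof.
have [s -> [sG sv0]] := loop_consP p.
rewrite lastI rev_rcons sv0 /= eqxx /= -{1}sv0 rev_path.
rewrite (eq_path (e' := @adj G)) ?sG; last by move=> x y; rewrite /= adj_sym.
case: s sv0 {sG} => [|x s] /= _; first by rewrite eqxx.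
by rewrite rev_cons last_rcons eqxx.
Qed.
Definition loop_inv (p : loop) := Loop (loop_inv_subproof p).

Definition loop_equiv : rel loop := fun p q => `[< homotopic p q >].

Lemma loop_equiv_refl : reflexive loop_equiv.
Proof. by move=> p; apply/asboolP; apply: rt_refl. Qed.

Lemma loop_equiv_sym : symmetric loop_equiv.
Proof.
by move=> p q; apply/asboolP/asboolP; apply/homotopic_sym/loop_sorted.
Qed.

Lemma loop_equiv_trans : transitive loop_equiv.
Proof.
by move=> q p r /asboolP pq /asboolP qr; apply/asboolP; apply: rt_trans qr.
Qed.

Canonical loop_equiv_rel :=
  EquivRel loop_equiv loop_equiv_refl loop_equiv_sym loop_equiv_trans.

Definition pi1 := {eq_quot loop_equiv}%qT.
HB.instance Definition _ := Choice.on pi1.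
HB.instance Definition _ := EqQuotient.on pi1.

Lemma loop_mul_equiv (p p' q q' : loop) :
  homotopic p p' -> homotopic q q' ->
  homotopic (loop_mul p q) (loop_mul p' q').
Proof.
move=> pp' qq'; rewrite /loop_mul /=.
apply: (@rt_trans _ _ _ (p' ++ behead q)); first exact: homotopic_catr.
have [s ->] := loop_rconsP p'.
have catE (t : loop) : rcons s v0 ++ behead t = s ++ t.
  by have [t' -> _] := loop_consP t; rewrite cat_rcons.
by rewrite !catE; apply: homotopic_catl.
Qed.

Definition pi1_class (p : loop) : pi1 := (\pi_pi1 p)%qT.
Definition pi1_one : pi1 := pi1_class loop_one.
Definition pi1_mul (a b : pi1) : pi1 := pi1_class (loop_mul (repr a) (repr b)).
Definition pi1_inv (a : pi1) : pi1 := pi1_class (loop_inv (repr a)).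

Lemma pi1_classP (p q : loop) :
  reflect (homotopic p q) (pi1_class p == pi1_class q).
Proof. by rewrite /pi1_class eqmodE; apply: asboolP. Qed.

Lemma pi1_classW (P : pi1 -> Prop) :
  (forall p, P (pi1_class p)) -> forall a, P a.
Proof. by move=> Pp a; rewrite -[a]reprK; apply: Pp. Qed.

Lemma repr_pi1_class (p : loop) : homotopic (repr (pi1_class p)) p.
Proof. by apply/pi1_classP/eqP; rewrite /pi1_class reprK. Qed.

Lemma pi1_mulE (p q : loop) :
  pi1_mul (pi1_class p) (pi1_class q) = pi1_class (loop_mul p q).
Proof.
by apply/eqP/pi1_classP; apply: loop_mul_equiv; apply: repr_pi1_class.
Qed.

Lemma pi1_invE (p : loop) : pi1_inv (pi1_class p) = pi1_class (loop_inv p).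
Proof. by apply/eqP/pi1_classP; apply/homotopic_rev/repr_pi1_class. Qed.

Lemma pi1_mulA : associative pi1_mul.
Proof.
elim/pi1_classW=> p; elim/pi1_classW=> q; elim/pi1_classW=> r.
rewrite !pi1_mulE; congr pi1_class; apply/val_inj => /=.
by have [s -> _] := loop_consP q; rewrite /= catA.
Qed.

Lemma pi1_mul1 : left_id pi1_one pi1_mul.
Proof.
elim/pi1_classW=> p; rewrite pi1_mulE; congr pi1_class; apply/val_inj => /=.
by have [s -> _] := loop_consP p.
Qed.

Lemma pi1_mulr1 : right_id pi1_one pi1_mul.
Proof.
elim/pi1_classW=> p; rewrite pi1_mulE; congr pi1_class; apply/val_inj => /=.
by rewrite cats0.
Qed.

Lemma pi1_mulrV : right_inverse pi1_one pi1_inv pi1_mul.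
Proof.
elim/pi1_classW=> p; rewrite pi1_invE pi1_mulE; apply/eqP/pi1_classP => /=.
by have [s -> _] := loop_consP p; apply: homotopic_catV.
Qed.

Lemma pi1_mulV : left_inverse pi1_one pi1_inv pi1_mul.
Proof.
elim/pi1_classW=> p; rewrite -[in RHS](pi1_mulrV (pi1_class (loop_inv p))).
rewrite !pi1_invE; congr (pi1_mul _ (pi1_class _)).
by apply/val_inj; rewrite /= revK.
Qed.

HB.instance Definition _ :=
  isGroup.Build pi1 pi1_mulA pi1_mul1 pi1_mulr1 pi1_mulV pi1_mulrV.

End FundamentalGroup.

Definition is_cyclic (T : groupType) : Prop :=
  exists g : T, forall x : T, exists n : nat, x = (g ^+ n)%g \/ x = (g ^- n)%g.

(* Main.v *)
Require Import Defs.
From Stdlib Require Import Relation_Operators.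
From mathcomp Require Import all_boot.
From mathcomp Require Import boolp zify.

(** Write [g = 2r+1]. A mod-2 edge weight on [H] whose sum around every square
    vanishes has homotopy-invariant sums along the images of walks of [G]. As the
    fundamental group is cyclic, a weight which is odd on [phi(C)] has the parity
    of the length on all closed walks, so that [G] gets a 2-coloring [c] such that
    every edge with [c]-monochromatic ends has weight 1.

    The edges of [H] fall into classes generated by squares; the indicator of a
    class [k], and its restriction to the edges at one vertex, are such weights.
    Some class is odd on [phi(C)]. If it is odd at some corner, then [c] and the
    position of that corner give a 4-coloring of [G]. Otherwise [k] contains an odd
    cycle on the at most [2r+2] vertices of [phi(C)], and as [H] has no
    (2r+1)-cycle, a shortest odd cycle [D] of [k] has length at most [2r-1].

    Every edge of [k] then lies on a closed walk of odd length at most [2r-1]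
    formed with an arc of [D] and two tails: crossing a square lengthens it by
    at most 2, and there is no cycle of length [2r+1]. So the edges of [k] are
    within distance [r-1] of [D]. By the argument of Erdos, Faudree, Rousseau and
    Schelp, each sphere of radius less than [r] in a (2r+1)-cycle-free graph is
    (2r-1)-colorable. Coloring the vertices near [D] by a root in [D], the parity
    of the distance and the sphere color, and the other ones by [c], uses at most
    [2(2r-1)^2 + 2 < 8r^2] colors. *)

Set Implicit Arguments.
Unset Strict Implicit.
Unset Printing Implicit Defensive.

(** * Sums along walks and homotopy *)

Section WalkSum.
Variables (G : sgraph) (g : rel G).

Fixpoint walk_sum x (p : seq G) : bool :=
  if p is y :: p' then g x y (+) walk_sum y p' else false.

Definition list_sum (s : seq G) := if s is x :: p then walk_sum x p else false.

Lemma walk_sum_cat x p q :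
  walk_sum x (p ++ q) = walk_sum x p (+) walk_sum (last x p) q.
Proof. by elim: p x => //= y p IH x; rewrite IH addbA. Qed.

Lemma list_sum_cat s x p :
  list_sum (s ++ x :: p) = list_sum (rcons s x) (+) walk_sum x p.
Proof.
by case: s => //= y s; rewrite -cat_rcons walk_sum_cat last_rcons.
Qed.

Hypothesis g_sym : symmetric g.

Hypothesis g_square : forall a x y b, adj a x -> adj x b -> adj a y -> adj y b ->
  g a x (+) g x b = g a y (+) g y b.

(** A substitution is the square condition; an insertion or a deletion counts the edge [xw] twice,
    which vanishes modulo 2. *)
Lemma hstep_sum s t : sorted (@adj G) s -> hstep s t -> list_sum s = list_sum t.
Proof.
move=> + st; case: st => [s1 s2 a x b y ay yb|s1 s2 x w xw|s1 s2 x w];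
  rewrite sorted_cat_cons !list_sum_cat /=.
- by case/and4P=> _ ax xb _; congr addb; rewrite !addbA (g_square ax xb ay yb).
- by move=> _; rewrite [g w x]g_sym addKb.
- by move=> _; rewrite [g w x]g_sym addKb.
Qed.

Lemma homotopic_sum s t : sorted (@adj G) s -> homotopic s t ->
  list_sum s = list_sum t.
Proof.
move=> sG st; suff [] : sorted (@adj G) t /\ list_sum s = list_sum t by [].
elim: st sG => {s t} [s t st sG|//|s t u _ IHs _ IHt sG].
  by split; [case: (hstep_walk sG st)|apply: hstep_sum].
by have [/IHt[uG <-] ->] := IHs sG.
Qed.

Variable v0 : G.

Lemma loop_mul_sum (p q : loop v0) :
  list_sum (loop_mul p q) = list_sum p (+) list_sum q.
Proof.
have [s /= -> [_ sv]] := loop_consP p; have [t -> _] := loop_consP q.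
by rewrite /= walk_sum_cat sv.
Qed.

(** By homotopy invariance every representative gives the same value, so this is a homomorphism to
    Z/2. *)
Definition class_sum (a : pi1 v0) : bool := list_sum (repr a).

Lemma class_sumE (p : loop v0) : class_sum (pi1_class p) = list_sum p.
Proof. by apply: homotopic_sum (loop_sorted _) (repr_pi1_class p). Qed.

Lemma class_sumM a b : class_sum (a * b)%g = class_sum a (+) class_sum b.
Proof. by rewrite [class_sum (_ * _)%g]class_sumE loop_mul_sum. Qed.

Lemma class_sum1 : class_sum 1%g = false.
Proof. exact: class_sumE. Qed.

Lemma class_sumV a : class_sum (a^-1)%g = class_sum a.
Proof.
by have := class_sumM a (a^-1)%g; rewrite mulgV class_sum1; do 2!case: class_sum.
Qed.

Lemma class_sumX a n : class_sum (a ^+ n)%g = odd n && class_sum a.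
Proof.
elim: n => [|n IH]; first by rewrite expg0 class_sum1.
by rewrite expgS class_sumM IH /=; case: (odd n); case: class_sum.
Qed.

End WalkSum.

(** The return walk is found before the weight, so that one [q] serves all symmetric weights. *)
Lemma walk_sum_back (G : sgraph) (x : G) p : path (@adj G) x p -> exists q,
  [/\ path (@adj G) (last x p) q, last (last x p) q = x &
      forall g, symmetric g -> walk_sum g (last x p) q = walk_sum g x p].
Proof.
elim: p x => [|y p IH] x /=; first by exists [::].
case/andP=> xy /IH[q [P L S]]; exists (rcons q x).
rewrite rcons_path P L last_rcons adj_sym xy; split=> // g g_sym.
by rewrite -cats1 walk_sum_cat L S //= addbF addbC g_sym.
Qed.

Lemma walk_sum_length (G : sgraph) x (p : seq G) :
  walk_sum (fun _ _ => true) x p = odd (size p).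
Proof. by elim: p x => //= y p IH x; rewrite IH. Qed.

Lemma walk_sum_addb (G : sgraph) (g : rel G) x p :
  walk_sum (fun u v => ~~ g u v) x p = walk_sum g x p (+) odd (size p).
Proof.
by elim: p x => //= y p IH x; rewrite IH; case: (g x y); case: (walk_sum g y p); case: (odd _).
Qed.

(* A homomorphism from a cyclic group to Z/2 is determined by its value at any
   element which is not a square; here both the parity of the length and the sum
   of [g] equal 1 on [x :: p]. *)
Lemma cocycle_coloring (G : sgraph) (v0 : G) (g : rel G) x p :
  connected G -> is_cyclic (pi1 v0) -> symmetric g ->
  (forall a x y b, adj a x -> adj x b -> adj a y -> adj y b ->
    g a x (+) g x b = g a y (+) g y b) ->
  path (@adj G) x p -> last x p = x -> odd (size p) -> walk_sum g x p ->
  exists c : G -> bool, forall u v, adj u v -> c u = c v -> g u v.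
Proof.
move=> G_conn [a0 cyc] g_sym g_sq xp lp op gp.
(* Sums of [t] are parities of lengths, and [d] is [g] plus [t]. On closed walks at [v0] the sums of
   [d] will vanish, which makes [d] the coboundary of a 2-coloring. *)
pose t (_ _ : G) := true; pose d := fun u v => ~~ g u v.
have d_sym : symmetric d by move=> u v; rewrite /d g_sym.
have d_sq a y z b : adj a y -> adj y b -> adj a z -> adj z b ->
    d a y (+) d y b = d a z (+) d z b.
  move=> h1 h2 h3 h4; have := g_sq _ _ _ _ h1 h2 h3 h4; rewrite /d.
  by case: (g a y); case: (g y b); case: (g a z); case: (g z b).
have walk y : exists q, path (@adj G) v0 q /\ last v0 q = y.
  by have /connectP[q qP ->] := G_conn v0 y; exists q.
have loopP q : path (@adj G) v0 q -> last v0 q = v0 -> closed_walk_at v0 (v0 :: q).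
  by move=> P L; rewrite /= eqxx P L eqxx.
have [q [qP ql]] := walk x; have [q' [q'P q'l q's]] := walk_sum_back qP.
rewrite ql in q'P q'l q's.
(* The odd closed walk is moved to the base point; the contributions of [q] and [q'] cancel. *)
have lP : path (@adj G) v0 (q ++ p ++ q') by rewrite !cat_path qP ql xp lp q'P.
have lL : last v0 (q ++ p ++ q') = v0 by rewrite !last_cat ql lp.
pose w := Loop (loopP _ lP lL).
have sumw (f : rel G) : symmetric f -> list_sum f w = walk_sum f x p.
  move=> f_sym; rewrite /= !walk_sum_cat ql lp q's //.
  by rewrite addbC -addbA addbb addbF.
have t_sq a y z b : adj a y -> adj y b -> adj a z -> adj z b ->
    t a y (+) t y b = t a z (+) t z b by [].
have t_sym : symmetric t by [].
(* The class of [w] is a power of [a0] or the inverse of one, and both its sums are odd; hence both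
   sums are odd on [a0]. *)
have agree (b : pi1 v0) : class_sum g b = class_sum t b.
  have a0g : class_sum g a0.
    have [n] := cyc (pi1_class w).
    have := class_sumE g_sym g_sq w; rewrite sumw // gp => + E.
    by case: E => ->; rewrite ?(class_sumV g_sym g_sq) (class_sumX g_sym g_sq) => /andP[].
  have a0t : class_sum t a0.
    have [n] := cyc (pi1_class w).
    have := class_sumE t_sym t_sq w; rewrite sumw // walk_sum_length op => + E.
    by case: E => ->; rewrite ?(class_sumV t_sym t_sq) (class_sumX t_sym t_sq) => /andP[].
  have [n] := cyc b; case=> ->;
    rewrite ?(class_sumV t_sym t_sq) ?(class_sumV g_sym g_sq);
    by rewrite (class_sumX t_sym t_sq) (class_sumX g_sym g_sq) a0g a0t.
have closed s : path (@adj G) v0 s -> last v0 s = v0 -> walk_sum d v0 s = false.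
  move=> sP sl; pose l := Loop (loopP _ sP sl).
  have := agree (pi1_class l).
  rewrite (class_sumE g_sym g_sq) (class_sumE t_sym t_sq) /= walk_sum_addb => ->.
  by rewrite walk_sum_length addbb.
have /choice[Q QP] := walk.
(* If [u] and [v] have equal colors, the closed walk along [Q u], the edge [uv] and back along [Q v]
   has sum [d u v], which is therefore 0. *)
exists (fun v => walk_sum d v0 (Q v)) => u v uv cuv.
have [[uP ul] [vP vl]] := (QP u, QP v).
have [b [bP bl bs]] := walk_sum_back vP; rewrite vl in bP bl bs.
have := closed (Q u ++ v :: b); rewrite cat_path last_cat ul /= uP uv bP bl.
rewrite walk_sum_cat ul /= bs // cuv => /(_ erefl erefl).
by rewrite addbC -addbA addbb addbF => /negbFE.
Qed.

(** * Shortest odd cycles *)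

Section MinOddCycle.
Variables (T : eqType) (k : rel T).

Definition odd_closed n := exists x p,
  [/\ path k x p, last x p = x, size p = n & odd n].

(** The cycle is indexed periodically by [nat], so that arcs are images of intervals. Minimality is
    among all odd closed walks. *)
Record shortest_odd_cycle n (d : nat -> T) : Prop := ShortestOddCycle {
  soc_odd : odd n;
  soc_min : forall x p, path k x p -> last x p = x -> odd (size p) -> n <= size p;
  soc_per : forall i, d (i + n) = d i;
  soc_path : forall i, k (d i) (d i.+1);
  soc_inj : forall i j, d i = d j -> i = j %[mod n] }.

Lemma last_iterates (d : nat -> T) i l :
  last (d i) [seq d j | j <- iota i.+1 l] = d (i + l).
Proof. by elim: l i => [|l IH] i /=; rewrite ?addn0 // IH addSnnS. Qed.

Lemma path_iterates (d : nat -> T) (dP : forall i, k (d i) (d i.+1)) i l :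
  path k (d i) [seq d j | j <- iota i.+1 l].
Proof. by elim: l i => //= l IH i; rewrite dP IH. Qed.

Lemma soc_cycle n d : shortest_odd_cycle n d -> cycle k (mkseq d n).
Proof.
case: n => // n S; have := path_iterates (soc_path S) 0 n.+1.
have -> : iota 1 n.+1 = rcons (iota 1 n) n.+1.
  by rewrite -{1}[n.+1]addn1 iotaD cats1 add1n.
by rewrite map_rcons -[X in rcons _ (d X)]add0n (soc_per S).
Qed.

(** A repeated vertex would split a shortest odd closed walk into two closed walks, one of them odd
    and shorter. *)
Lemma min_odd_cycle m : odd_closed m ->
  exists n d, n <= m /\ shortest_odd_cycle n d.
Proof.
move=> om; pose P j := `[< odd_closed j >].
have exP : exists j, P j by exists m; apply/asboolP.
case: (ex_minnP exP) => n /asboolP[x [p [kp lp sp on]]] nmin.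
have n0 : 0 < n by case: (n) on.
pose d i := nth x (x :: p) (i %% n).
exists n, d; split; first by apply: nmin; apply/asboolP.
have dn i : i <= n -> d i = nth x (x :: p) i.
  rewrite leq_eqVlt => /predU1P[->|lt]; last by rewrite /d modn_small.
  by rewrite /d modnn -sp -last_nth lp.
have dmod i : d (i %% n) = d i by rewrite /d modn_mod.
have min' y q : path k y q -> last y q = y -> odd (size q) -> n <= size q.
  by move=> kq lq oq; apply: nmin; apply/asboolP; exists y, q.
split=> //.
- by move=> i; rewrite -dmod modnDr dmod.
- move=> i; have li := ltn_pmod i n0; have -> : d i.+1 = d (i %% n).+1.
    by rewrite -(dmod (i %% n).+1) -[(i %% n).+1]addn1 modnDml addn1 dmod.
  rewrite -dmod !dn //; last exact: ltnW.
  by move/pathP: kp => /(_ x); apply; rewrite sp.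
have sub i j : i < j -> j < n -> d i = d j -> False.
  move=> ij jn; rewrite !dn; try by [lia|exact: ltnW].
  pose q := take (j - i) (drop i p); pose w := take i p ++ drop j p.
  move=> e.
  have sq : size q = j - i by rewrite size_takel // size_drop sp leq_sub2r // ltnW.
  have sw : size w = n - (j - i).
    by rewrite size_cat size_takel ?size_drop sp; lia.
  have pE : p = take i p ++ q ++ drop j p.
    rewrite -[in LHS](cat_take_drop i p); congr cat.
    rewrite -[in LHS](cat_take_drop (j - i) (drop i p)) drop_drop subnK //.
    exact: ltnW.
  have li : last x (take i p) = nth x (x :: p) i.
    rewrite (last_nth x) size_takel ?sp; last lia.
    by case: (i) => //= a; rewrite nth_take.
  have lj : last (nth x (x :: p) i) q = nth x (x :: p) j.
    have : last x (take j p) = nth x (x :: p) j.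
      rewrite (last_nth x) size_takel ?sp; last lia.
      by case: (j) => //= a; rewrite nth_take.
    move=> <-; rewrite -li -last_cat; congr last.
    rewrite /q take_drop subnK; last exact: ltnW.
    by rewrite -[in RHS](cat_take_drop i (take j p)) take_takel // ltnW.
  move: kp lp; rewrite pE !cat_path !last_cat li lj -e => /and3P[k1 k2 k3] l3.
  have [o|o] := boolP (odd (j - i)).
    have := min' (nth x (x :: p) i) q k2; rewrite sq lj -e => /(_ erefl o); lia.
  have := min' x w; rewrite /w cat_path last_cat li k1 k3 l3 -/w sw.
  move=> /(_ erefl erefl); move: o on ij jn; clear; lia.
move=> i j; rewrite -(dmod i) -(dmod j) => e.
have [li lj] := (ltn_pmod i n0, ltn_pmod j n0).
by case: (ltngtP (i %% n) (j %% n)) => // lt; [case: (sub _ _ lt)|case: (sub _ _ lt)].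
Qed.

End MinOddCycle.

(** * Square classes *)

Section TwoColoring.
Variables (T : finType) (k : rel T).
Hypothesis k_sym : symmetric k.

Lemma path_back x p : path k x p -> exists q,
  [/\ path k (last x p) q, last (last x p) q = x & size q = size p].
Proof.
elim: p x => [|y p IH] x /=; first by exists [::].
case/andP=> xy /IH[q [P L S]]; exists (rcons q x).
by rewrite rcons_path P L last_rcons k_sym xy size_rcons S.
Qed.

(** Each vertex gets the parity of a chosen walk from the root of its component; a monochromatic
    edge would close two such walks to an odd one. *)
Lemma two_coloring : ~ (exists n, odd_closed k n) ->
  exists c : T -> bool, forall x y, k x y -> c x != c y.
Proof.
move=> no.
have /choice[Q QP] : forall x, exists q, path k (root k x) q /\ last (root k x) q = x.
  move=> x; have /connectP[q qP xq] : connect k (root k x) x.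
    by rewrite (sym_connect_sym k_sym) connect_root.
  by exists q.
exists (fun x => odd (size (Q x))) => x y xy; apply/negP => /eqP cxy.
have rxy : root k x = root k y by apply/(rootP (sym_connect_sym k_sym))/connect1.
have [[xP xl] [yP yl]] := (QP x, QP y).
have [b [bP bl bs]] := path_back yP; rewrite yl in bP bl.
apply: no; exists (size (Q x ++ y :: b)), (root k x), (Q x ++ y :: b); split=> //.
- by rewrite cat_path xP xl /= xy.
- by rewrite last_cat /= bl.
by rewrite size_cat /= oddD oddS bs cxy; case: (odd _).
Qed.

End TwoColoring.

Section SquareClasses.
Variable H : sgraph.

(** Edges are directed so that a step can turn at a corner of a 4-cycle; together with reversals
    this makes all four sides equivalent, in both directions. *)
Definition square_step := [rel p q : H * H | [&& adj p.1 p.2, adj q.1 q.2 &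
  (q == (p.2, p.1)) || [&& q.1 == p.2, p.1 != q.2 &
     [exists a, [&& adj q.2 a, adj a p.1 & p.2 != a]]]]].

Definition square_class (e0 : H * H) : rel H := fun x y => connect square_step e0 (x, y).

Lemma square_stepP a b b' a' : adj a b -> adj b b' -> adj b' a' -> adj a' a ->
  a != b' -> b != a' -> square_step (a, b) (b, b').
Proof.
move=> ab bb' b'a' a'a n1 n2; rewrite /= ab bb' eqxx n1 /=.
by apply/orP; right; apply/existsP; exists a'; rewrite b'a' a'a.
Qed.

Lemma flip_step a b : adj a b -> square_step (a, b) (b, a).
Proof. by move=> ab; rewrite /= ab adj_sym ab eqxx. Qed.

Lemma square_step_adj p q : connect square_step p q -> adj p.1 p.2 -> adj q.1 q.2.
Proof.
case/connectP=> s sP ->; elim: s p sP => //= q' s IH p /andP[/and3P[_ q'q' _]] sP _.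
exact: IH.
Qed.

(** This serves the symmetry below and, in the end, the spread of [good] from one edge of the
    shortest odd cycle to its class. *)
Lemma square_step_ind (P : H -> H -> Prop) a0 b0 : P a0 b0 ->
  (forall a b, P a b -> P b a) ->
  (forall a b b' a', adj a b -> adj b b' -> adj b' a' -> adj a' a ->
     a != b' -> b != a' -> P a b -> P b b') ->
  forall a b, connect square_step (a0, b0) (a, b) -> P a b.
Proof.
move=> P0 Psym Pstep a b /connectP[s sP El].
suff: P (last (a0, b0) s).1 (last (a0, b0) s).2 by rewrite -El.
elim: s a0 b0 P0 sP {El} => //= -[x y] s IH a0 b0 P0 /andP[+ sP] /=.
case/and3P=> ab xy step; apply: IH sP.
case/orP: step => [/eqP[-> ->]|/and3P[/eqP /= Ex n1 /existsP[a' /and3P[h1 h2 h3]]]].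
  exact: Psym.
by subst x; apply: Pstep P0; eauto.
Qed.

(** The turn from [ab] to [bb'] is undone by reversing [bb'], turning to [ba] and reversing again.
    No step leaves a pair that is not an edge. *)
Lemma square_class_sym : connect_sym square_step.
Proof.
suff sub p q : connect square_step p q -> connect square_step q p.
  by move=> p q; apply/idP/idP; apply: sub.
case: p q => a0 b0 [a b]; have [ab0|ab0] := boolP (adj a0 b0); last first.
  case/connectP=> -[_ ->|q s /= /andP[/and3P[]]]; first exact: connect0.
  by rewrite (negPf ab0).
move=> c0; suff: adj a b /\ connect square_step (a, b) (a0, b0) by case.
move: a b c0; apply: square_step_ind.
- by [].
- move=> a b [ab c]; split; first by rewrite adj_sym.
  by apply: connect_trans c; apply/connect1/flip_step; rewrite adj_sym.
move=> a b b' a' ab bb' b'a' a'a n1 n2 [_ c]; split=> //.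
apply: connect_trans c.
apply: (@connect_trans _ _ (b', b)); first exact/connect1/flip_step.
apply: (@connect_trans _ _ (b, a)).
  by apply/connect1/(square_stepP (a' := a')); rewrite // 1?adj_sym // eq_sym.
by apply/connect1/flip_step; rewrite adj_sym.
Qed.

Variable e0 : H * H.
Hypothesis e0_adj : adj e0.1 e0.2.
Let k := square_class e0.

Lemma square_class_adj : subrel k (@adj H).
Proof. by move=> x y /square_step_adj; apply. Qed.

Lemma square_class_symm : symmetric k.
Proof.
suff sub x y : k x y -> k y x by move=> x y; apply/idP/idP; apply: sub.
move=> kxy; apply: (connect_trans kxy); apply/connect1/flip_step.
exact: square_class_adj.
Qed.

Lemma square_class_square a b b' a' : adj a b -> adj b b' -> adj b' a' ->
  adj a' a -> a != b' -> b != a' -> k a b = k b b'.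
Proof.
move=> h1 h2 h3 h4 n1 n2.
apply: (same_connect_r square_class_sym); apply: connect1.
exact: square_stepP h3 h4 n1 n2.
Qed.

(** The sides of a genuine square are all in [k] or all outside, so both sums are 0. In a degenerate
    square the two walks coincide or each retraces an edge. *)
Lemma square_class_cocycle a x y b :
  adj a x -> adj x b -> adj a y -> adj y b -> k a x (+) k x b = k a y (+) k y b.
Proof.
move=> ax xb ay yb; have [->//|xy] := eqVneq x y.
have [<-|ab] := eqVneq a b.
  by rewrite ![k _ a]square_class_symm !addbb.
have -> : k a x = k x b.
  by apply: (square_class_square (a' := y)); rewrite // adj_sym.
have -> : k a y = k y b.
  by apply: (square_class_square (a' := x)); rewrite // 1?adj_sym // eq_sym.
by rewrite !addbb.
Qed.

Definition corner v : rel H := fun x y => k x y && ((x == v) || (y == v)).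

Lemma corner_sym v : symmetric (corner v).
Proof. by move=> x y; rewrite /corner square_class_symm orbC. Qed.

(** In a genuine square with sides in [k], each of the two walks has exactly one side at [v] if [v]
    is [a] or [b], and otherwise none or two. *)
Lemma corner_cocycle v a x y b : adj a x -> adj x b -> adj a y -> adj y b ->
  corner v a x (+) corner v x b = corner v a y (+) corner v y b.
Proof.
move=> ax xb ay yb; have [->//|xy] := eqVneq x y.
have [<-|ab] := eqVneq a b.
  by rewrite ![corner v _ a]corner_sym !addbb.
have neq u w : adj u w -> u != w.
  by move=> uw; apply: contraTneq uw => ->; rewrite adj_irrefl.
have kx : k a x = k x b.
  by apply: (square_class_square (a' := y)); rewrite // adj_sym.
have ky : k a y = k y b.
  by apply: (square_class_square (a' := x)); rewrite // 1?adj_sym // eq_sym.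
have kxy : k a x = k a y.
  rewrite kx ky [RHS]square_class_symm.
  by apply: (square_class_square (a' := a)); rewrite // 1?adj_sym // eq_sym.
rewrite /corner -kx -ky -kxy; case: (k a x) => //=.
have := neq _ _ _ ax; have := neq _ _ _ xb; have := neq _ _ _ ay.
have := neq _ _ _ yb => {neq kx ky kxy} /negPf yb' /negPf ay' /negPf xb' /negPf ax'.
have [<-|_] := eqVneq a v.
  by rewrite ![_ == a]eq_sym ax' ay' (negPf ab).
have [<-|_] := eqVneq b v; first by rewrite xb' yb'.
by rewrite !orbF !addbb.
Qed.

Variables (z : H) (W : seq H).

(* If [c] 2-colors the edges of [k] on the walk, each of them is counted at exactly
   one of its ends, the one with [c v = true]. *)
Lemma corner_sum (c : H -> bool) :
  (forall x y, x \in z :: W -> y \in z :: W -> k x y -> c x != c y) ->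
  walk_sum k z W = \big[addb/false]_v (c v && walk_sum (corner v) z W).
Proof.
elim: W z => [|y p IH] x cP /=.
  by rewrite big1 // => v _; rewrite andbF.
under eq_bigr do rewrite andb_addr; rewrite big_split /= -IH; last first.
  by move=> u w us ws; apply: cP; rewrite inE ?us ?ws orbT.
congr addb; have cxy : k x y -> c x != c y by apply: cP; rewrite !inE eqxx ?orbT.
under eq_bigr do rewrite /corner.
have [kxy|_] := boolP (k x y); last by rewrite big1 // => v _; rewrite andbF.
have nxy : x != y.
  by apply: contraTneq (square_class_adj kxy) => ->; rewrite adj_irrefl.
rewrite (bigD1 x) // (bigD1 y) 1?eq_sym //= big1 => [|v /andP[vx vy]].
  rewrite !eqxx /= ?orbT ?andbT ?addbF; have := cxy kxy.
  by case: (c x); case: (c y).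
by rewrite ![_ == v]eq_sym (negPf vx) (negPf vy) andbF.
Qed.

End SquareClasses.

(** The classes, each indexed by its [root], partition the edges, so their sums along [W] add up to
    the parity of the length. *)
Lemma odd_square_class (H : sgraph) (z : H) W : path (@adj H) z W ->
  odd (size W) -> exists e0 : H * H, adj e0.1 e0.2 /\ walk_sum (square_class e0) z W.
Proof.
move=> WP oW.
have key : \big[addb/false]_(e0 | root (@square_step H) e0 == e0)
    walk_sum (square_class e0) z W = odd (size W).
  elim: W z WP {oW} => [|y p IH] x /=; first by rewrite big1.
  case/andP=> xy pP; rewrite big_split /= (IH y) //.
  rewrite (bigD1 (root (@square_step H) (x, y))) /=; last first.
    by rewrite (eqP (roots_root (@square_class_sym H) _)).
  rewrite {1}/square_class square_class_sym connect_root big1 ?addbF //.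
  move=> e0 /andP[/eqP re0 ne]; apply: contraNF ne => c.
  by rewrite -re0; apply/eqP/(rootP (@square_class_sym H)).
have [e0 /andP[_ e0W]|none] := pickP (fun e0 : H * H =>
   (root (@square_step H) e0 == e0) && walk_sum (square_class e0) z W); last first.
  move: key; rewrite oW big1 // => e0 e0r.
  by have := none e0; rewrite /= e0r.
(* The index also ranges over pairs that are not edges; an odd sum puts an edge of the walk in the
   class, and so [e0] is an edge. *)
exists e0; split=> //; move: e0W.
elim: W z WP {oW key} => //= y p IH x /andP[xy pP].
have [c _|_ /= ] := boolP (square_class e0 x y); last exact: IH.
move: c; rewrite /square_class square_class_sym => /square_step_adj; exact.
Qed.

Lemma odd_closed_walk_class (H : sgraph) r (z : H) W :
  cycle_free (2 * r + 1) H -> path (@adj H) z W -> last z W = z -> odd (size W) ->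
  #|[set x in z :: W]| <= 2 * r + 2 ->
  exists e0 : H * H, [/\ adj e0.1 e0.2, walk_sum (square_class e0) z W &
    (exists v, walk_sum (corner e0 v) z W) \/
    (exists n d, n <= 2 * r - 1 /\ shortest_odd_cycle (square_class e0) n d)].
Proof.
move=> H_free WP Wl oW leK.
have [e0 [e0_adj e0W]] := odd_square_class WP oW; exists e0; split=> //.
have [[v vW]|nov] := pselect (exists v, walk_sum (corner e0 v) z W).
  by left; exists v.
right; set k := square_class e0.
have k_sym : symmetric k := square_class_symm e0_adj.
have k_adj := square_class_adj e0_adj.
pose K := [set x in z :: W].
(* The restriction to the vertices of the walk bounds the length of a shortest odd cycle by
   [2 * r + 2]. *)
pose kK := [rel x y | [&& k x y, x \in K & y \in K]].
have kK_sym : symmetric kK by move=> x y /=; rewrite k_sym [(x \in K) && _]andbC.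
have [[m om]|no] := pselect (exists m, odd_closed kK m); last first.
  (* A 2-coloring of [kK] would write the odd sum along the walk as a sum of corner sums, all of
     which are even. *)
  have [c cP] := two_coloring kK_sym no.
  have := corner_sum e0_adj (c := c) (z := z) (W := W); rewrite e0W big1 => [|v _].
    move=> H0; suff: true = false by [].
    by apply: H0 => x y xK yK kxy; apply: cP; rewrite /= /k kxy !in_set xK yK.
  by apply/negP => /andP[_ vW]; apply: nov; exists v.
have [n [d [_ S]]] := min_odd_cycle om.
have dK i : d i \in K by have /and3P[] := soc_path S i.
have dk i : k (d i) (d i.+1) by have /and3P[] := soc_path S i.
have on := soc_odd S.
have uD : uniq (mkseq d n).
  rewrite map_inj_in_uniq ?iota_uniq // => i j.
  by rewrite !mem_iota /= => li lj /(soc_inj S); rewrite !modn_small.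
have n_gt2 : 2 < n.
  case: n S on {uD} => [|[|[|n]]] // S _.
  by have /k_adj := dk 0; rewrite -[1]add0n (soc_per S) adj_irrefl.
have len : n <= 2 * r + 2.
  apply: leq_trans leK; rewrite -[n](size_mkseq d) -(card_uniqP uD).
  by apply: subset_leq_card; apply/subsetP => y /mapP[i _ ->].
have ne : n <> 2 * r + 1.
  rewrite -[n](size_mkseq d); apply: H_free; split; last by rewrite size_mkseq.
  apply/andP; split=> //.
  apply: sub_cycle (soc_cycle S) => x y /and3P[kxy _ _]; exact: k_adj.
(* So far [d] is shortest only within [K]; confinement needs minimality among all odd closed walks
   of [k]. *)
have [|n' [d' [len' S']]] := @min_odd_cycle _ k n.
  exists (d 0), [seq d j | j <- iota 1 n]; split=> //.
  - exact: (@path_iterates _ k d dk 0).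
  - by rewrite last_iterates -[0 + n]/(n) -[n]add0n (soc_per S).
  - by rewrite size_map size_iota.
exists n', d'; split=> //; apply: leq_trans len' _; move: on len ne; clear; lia.
Qed.

(** * Confinement near a shortest odd cycle *)

(** Counts add over concatenation, so disjointness of rearranged tails becomes linear arithmetic. *)
Lemma uniq_count (T : eqType) (s t : seq T) : uniq s ->
  (forall P : pred T, count P t <= count P s) -> uniq t.
Proof.
move=> U le; apply: count_mem_uniq => x; move: (le (pred1 x)).
rewrite (count_uniq_mem _ U) -(has_pred1 x t) has_count.
by case: (count _ t) => [|[|?]] //; case: (x \in s).
Qed.

Lemma mem_split (T : eqType) (x : T) s : x \in s -> {s1 & {s2 | s = s1 ++ x :: s2}}.
Proof. by case/splitPr => s1 s2; exists s1, s2. Qed.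

Lemma dvdn_eq_double n m : n %| m -> 0 < m -> m < n + n -> m = n.
Proof.
case/dvdnP=> [[|[|q]]] ->; rewrite ?mul1n // !mulSn addnA => _.
by rewrite -ltn_subRL subnn.
Qed.

Section Confinement.
Variables (H : sgraph) (k : rel H) (r n : nat) (d : nat -> H).
Hypothesis H_free : cycle_free (2 * r + 1) H.
Hypothesis k_sym : symmetric k.
Hypothesis k_adj : subrel k (@adj H).
Hypothesis k_square : forall a b b' a', adj a b -> adj b b' -> adj b' a' ->
  adj a' a -> a != b' -> b != a' -> k a b -> k b b'.
Hypothesis n_odd : odd n.
Hypothesis n_le : n <= 2 * r - 1.
Hypothesis n_min : forall x p,
  path k x p -> last x p = x -> odd (size p) -> n <= size p.
Hypothesis d_per : forall i, d (i + n) = d i.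
Hypothesis d_path : forall i, k (d i) (d i.+1).
Hypothesis d_inj : forall i j, d i = d j -> i = j %[mod n].

Let D := mkseq d n.

Lemma ring_n_gt0 : 0 < n. Proof. by case: (n) n_odd. Qed.

Lemma d_mod i : d (i %% n) = d i.
Proof.
rewrite [in RHS](divn_eq i n); elim: (i %/ n) => [|q IH] //.
by rewrite mulSn -addnA addnC d_per.
Qed.

Lemma mem_d i : d i \in D.
Proof.
apply/mapP; exists (i %% n); last by rewrite d_mod.
by rewrite mem_iota ltn_mod ring_n_gt0.
Qed.

Lemma ringP x : reflect (exists i, x = d i) (x \in D).
Proof.
apply: (iffP idP) => [/mapP[i _ ->]|[i ->]]; [by exists i|exact: mem_d].
Qed.

(** Distinct vertices of [D] are joined by two arcs, of opposite parity as [n] is odd. The strict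
    bounds exclude equal ends. *)
Definition arc1 x y l := exists i, [/\ 0 < l, l < n, x = d i & y = d (i + l)].
Definition arc x y l := arc1 x y l \/ arc1 y x l.

Lemma arc_sym x y l : arc x y l -> arc y x l.
Proof. by case; [right|left]. Qed.

Lemma arc_bounds x y l : arc x y l -> 0 < l < n.
Proof. by case=> -[i [? ? _ _]]; apply/andP. Qed.

Lemma arc1_compl x y l : arc1 x y l -> arc1 y x (n - l).
Proof.
case=> i [l0 ln -> ->]; exists (i + l); split => //; [lia|lia|].
by rewrite -addnA subnKC ?d_per // ltnW.
Qed.

Lemma arc_compl x y l : arc x y l -> arc x y (n - l).
Proof. by case=> /arc1_compl; [right|left]. Qed.

Lemma arc1_exists i y : y \in D -> y != d i -> exists2 l, 0 < l < n & y = d (i + l).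
Proof.
have dD a l : d (a %% n + l) = d (a + l) by rewrite -d_mod modnDml d_mod.
have n0 := ring_n_gt0.
move=> /ringP[j ->]; rewrite -(d_mod i) -(d_mod j) => ne.
have neq : j %% n != i %% n by apply: contra ne => /eqP ->.
have jn := ltn_pmod j n0; have {n0} in_ := ltn_pmod i n0.
have [lt|lt] : i %% n < j %% n \/ j %% n < i %% n.
- by apply/orP; rewrite -neq_ltn eq_sym.
- exists (j %% n - i %% n); first by rewrite subn_gt0 lt (leq_ltn_trans _ jn) ?leq_subr.
  by rewrite -dD subnKC // ltnW.
exists (j %% n + n - i %% n).
  rewrite subn_gt0 ltn_addl //= ltn_subLR; last by rewrite (leq_trans (ltnW in_)) ?leq_addl.
  by rewrite ltn_add2r.
by rewrite -dD subnKC ?d_per // (leq_trans (ltnW in_)) ?leq_addl.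
Qed.

(** Two lengths in the same direction are congruent modulo [n]; two in opposite directions add up to
    a multiple of [n] strictly between 0 and [2n]. *)
Lemma arc_uniq x y l l' : arc x y l -> arc x y l' -> l' = l \/ l' = n - l.
Proof.
have sum i j u v : d i = d (j + v) -> d j = d (i + u) ->
    0 < u < n -> 0 < v < n -> u + v = n.
  move=> /d_inj/eqP e /d_inj/eqP e' ub vb.
  have : i + 0 == i + (u + v) %[mod n].
    rewrite addn0 (eqP e) addnA -(modnDml (i + u)) -(eqP e') modnDml; exact: eqxx.
  rewrite eqn_modDl mod0n eq_sym => dv.
  have [/andP[u0 un] /andP[v0 vn]] := (ub, vb).
  apply: (@dvdn_eq_double n) => //; first by rewrite addn_gt0 u0.
  by rewrite -addnS leq_add // ltnW.
have same i j u v : d i = d j -> d (i + u) = d (j + v) ->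
    0 < u < n -> 0 < v < n -> u = v.
  move=> /d_inj e /d_inj/eqP; rewrite -modnDml e modnDml eqn_modDl => /eqP.
  by move=> + ub vb; rewrite !modn_small //; lia.
move=> [] [i [l0 ln ex ey]] [] [j [l'0 l'n ex' ey']].
- left; apply/esym/(same i j); [by rewrite -ex| |lia|lia]; by rewrite -ey.
- right; have := sum i j l l'; rewrite -ex -ex' -ey -ey' => /(_ erefl erefl); lia.
- right; have := sum i j l l'; rewrite -ex -ex' -ey -ey' => /(_ erefl erefl); lia.
- left; apply/esym/(same i j); [by rewrite -ex| |lia|lia]; by rewrite -ey.
Qed.

Lemma arc_exists x y : x \in D -> y \in D -> x != y -> exists l, arc x y l.
Proof.
move=> /ringP[i ->] yD; rewrite eq_sym => /(arc1_exists yD)[l /andP[l0 ln] ->].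
by exists l; left; exists i.
Qed.

Lemma arc_path x y l : arc x y l -> exists q,
  [/\ path k x q, last x q = y, uniq (x :: q), all [in D] (x :: q) & size q = l].
Proof.
have arc1_path x' y' : arc1 x' y' l -> exists q, [/\ path k x' q, last x' q = y',
   uniq (x' :: q), all [in D] (x' :: q) & size q = l].
  case=> i [l0 ln -> ->]; exists [seq d j | j <- iota i.+1 l].
  split; rewrite ?last_iterates ?size_map ?size_iota //; first exact: path_iterates.
    rewrite -[_ :: _]/([seq d j | j <- iota i l.+1]) map_inj_in_uniq ?iota_uniq //.
    move=> a b; rewrite !mem_iota => /andP[a1 a2] /andP[b1 b2] /d_inj.
    rewrite -(subnKC a1) -(subnKC b1) => /eqP.
    by rewrite eqn_modDl !modn_small; [move/eqP->|lia|lia].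
  by apply/allP => z /=; rewrite inE => /predU1P[->|/mapP[j _ ->]]; apply: mem_d.
case=> [/arc1_path//|/arc1_path [q [P L U A S]]].
exists (behead (rev (y :: q))).
have E : rev (y :: q) = x :: behead (rev (y :: q)).
  by rewrite lastI L rev_rcons.
split.
- have : sorted k (rev (y :: q)).
    rewrite rev_sorted; by apply: sub_path P => a b; rewrite k_sym.
  by rewrite E.
- have : last x (rev (y :: q)) = y by rewrite rev_cons last_rcons.
  by rewrite E.
- by rewrite -E rev_uniq.
- by rewrite -E all_rev.
- by rewrite size_behead size_rev /= S.
Qed.

Lemma arc_odd_walk x p l : path k x p -> arc x (last x p) l ->
  odd (size p + l) -> n <= size p + l.
Proof.
move=> P /arc_sym/arc_path[q [Q L _ _ <-]]; rewrite -size_cat => o.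
by apply: (@n_min x) o; rewrite ?cat_path ?P // last_cat.
Qed.

Lemma arc3 x y z : x \in D -> y \in D -> z \in D -> x != y -> y != z -> x != z ->
  exists X Y Z, [/\ X + Y + Z = n, arc y z X, arc x z Y & arc x y Z].
Proof.
move=> /ringP[i ->] yD zD; rewrite eq_sym => xy yz; rewrite eq_sym => xz.
have [a /andP[a0 an] ya] := arc1_exists yD xy.
have [b /andP[b0 bn] zb] := arc1_exists zD xz.
have ab : a != b by apply: contra yz => /eqP ab; rewrite ya zb ab.
have [lt|lt] : a < b \/ b < a by lia.
  exists (b - a), (n - b), a; split; [lia| | |].
  - left; exists (i + a); split=> //; [lia|lia|].
    by rewrite zb -addnA subnKC // ltnW.
  - by apply: arc_compl; left; exists i.
  - by left; exists i.
exists (a - b), b, (n - a); split; [lia| | |].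
- right; exists (i + b); split=> //; [lia|lia|].
  by rewrite ya -addnA subnKC // ltnW.
- by left; exists i.
- by apply: arc_compl; left; exists i.
Qed.

Definition tail a A := [&& path k a A, all [predC D] (belast a A) & last a A \in D].

(* The tails [A] and [B] meet [D] only at their last vertices, and close up with
   the edge [ab] and an arc of [D] to an odd cycle. *)
Definition good a b := k a b /\ exists A B l,
  [/\ tail a A, tail b B, uniq (a :: A ++ b :: B), arc (last a A) (last b B) l
    & odd (size A + size B + 1 + l) && (size A + size B + 1 + l <= 2 * r - 1)].

Lemma tail_cons a b A : a \notin D -> k a b -> tail b A -> tail a (b :: A).
Proof. by rewrite /tail /= => -> -> /and3P[-> -> ->]. Qed.

Lemma tail_split a A1 x A2 : tail a (A1 ++ x :: A2) -> tail x A2.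
Proof.
rewrite /tail cat_path /= belast_cat all_cat last_cat /=.
by case/and3P=> /and3P[_ _ ->] /and3P[_ _ ->] ->.
Qed.

Lemma tail_head a A : tail a A -> A != [::] -> a \notin D.
Proof. by case: A => // b A /and3P[_ /= /andP[]]. Qed.

Lemma tail_all a A x : tail a A -> x \in a :: A -> x \in D -> x = last a A.
Proof.
case/and3P=> _ /allP no _; rewrite lastI mem_rcons inE => /predU1P[//|/no /=].
by move=> /negP.
Qed.

(* The bound is [2r+1] rather than [2r-1], as [H] has no cycle of length [2r+1]. *)
Lemma good_intro a b A B l : k a b -> tail a A -> tail b B ->
  uniq (a :: A ++ b :: B) -> arc (last a A) (last b B) l ->
  odd (size A + size B + 1 + l) -> size A + size B + 1 + l <= 2 * r + 1 ->
  good a b.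
Proof.
move=> kab tA tB U arcl o le; split=> //; exists A, B, l; split=> //.
rewrite o /=.
suff: size A + size B + 1 + l <> 2 * r + 1 by move: o; lia.
have [q [Q L Uq Dq Sq]] := arc_path arcl.
have l0 : 0 < l by case/andP: (arc_bounds arcl).
(* The cycle follows [A], the arc, and [B] backwards; [behead] drops the end of [B], with which [q]
   already ends. *)
pose c := (a :: A) ++ q ++ behead (rev (b :: B)).
have E : rev (b :: B) = last b B :: behead (rev (b :: B)).
  by rewrite lastI rev_rcons.
have -> : size A + size B + 1 + l = size c.
  by rewrite /c !size_cat size_behead size_rev /= Sq; lia.
apply: H_free; split; last first.
  by rewrite /c !size_cat size_behead size_rev /= Sq; move: o; lia.
apply/andP; split.
  rewrite /c /= rcons_path !cat_path !last_cat L.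
  have -> : path (@adj H) a A by case/and3P: tA => /(sub_path k_adj).
  rewrite (sub_path k_adj Q) /=.
  have S : sorted (@adj H) (rev (b :: B)).
    rewrite rev_sorted; case/and3P: tB => /(sub_path k_adj) + _ _.
    apply: sub_path => u v; by rewrite adj_sym.
  move: S; rewrite E /= => -> /=.
  have -> : last (last b B) (behead (rev (b :: B))) = b.
    by have : last b (rev (b :: B)) = b by [rewrite rev_cons last_rcons]; rewrite E.
  by rewrite k_adj // k_sym.
have U' : uniq ((a :: A) ++ rev (b :: B)).
  by rewrite (perm_uniq (s2 := (a :: A) ++ b :: B)) // perm_cat2l perm_rev.
rewrite /c; move: U'; rewrite E !cat_uniq => /and3P[-> hA] /= /andP[nb ub].
move: Uq => /= /andP[xq uq]; rewrite uq ub /= andbT.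
have qD z : z \in q -> z \in D by move=> zq; case/andP: Dq => _ /allP; apply.
apply/andP; split.
  apply/hasPn => z; rewrite mem_cat => /orP[zq|zb].
    apply: contra xq => zA; have := tail_all tA zA (qD _ zq) => <-.
    by [].
  by move: hA; apply: contra => zA; apply/hasP; exists z => //=; rewrite inE zb orbT.
apply/hasPn => z zb; apply: contra nb => zq.
suff <- : z = last b B by [].
apply: (tail_all tB _ (qD _ zq)).
by rewrite -mem_rev E inE zb orbT.
Qed.

Lemma good_sym a b : good a b -> good b a.
Proof.
case=> kab [A [B [l [tA tB U al /andP[o le]]]]].
apply: (good_intro (A := B) (B := A) (l := l)) => //; first by rewrite k_sym.
- by rewrite -cat_cons uniq_catC.
- exact: arc_sym.
- by move: o; rewrite (addnC (size A)).
- lia.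
Qed.

(** This covers new tails joined by an arc of the old length [l]. If the parity of the tails
    changes, the complementary arc [n - l] is used; as [l] is at least 1, the bound with 4 still
    gives length at most [2r+1]. *)
Lemma good_same (A B : seq H) l A' B' a' b' :
  odd (size A + size B + 1 + l) -> size A + size B + 1 + l <= 2 * r - 1 ->
  k a' b' -> tail a' A' -> tail b' B' -> uniq (a' :: A' ++ b' :: B') ->
  arc (last a' A') (last b' B') l ->
  (if odd (size A' + size B') == odd (size A + size B)
   then size A' + size B' <= size A + size B + 2
   else size A' + size B' + n <= size A + size B + 4) ->
  good a' b'.
Proof.
move=> o le kab tA tB U al; case/andP: (arc_bounds al) => l0 ln.
case: eqP => [e|ne] b1.
  by apply: (good_intro kab tA tB U al); move: e o b1; lia.
by apply: (good_intro kab tA tB U (arc_compl al)); move: ne o b1 n_odd; lia.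
Qed.

(** The part of a path up to a neighbor of its start closes up. If it is odd, its removal pays for
    the complementary arc in [good_same]. *)
Lemma split_cycle x y P Q : path k x (P ++ y :: Q) -> k y x ->
  odd (size P) -> n <= (size P).+2.
Proof.
rewrite cat_path /= => /and3P[pP py _] yx o.
have := @n_min x (P ++ [:: y; x]).
rewrite cat_path last_cat /= pP py yx size_cat addn2; apply=> //.
by rewrite /= negbK.
Qed.

(** All sides of the square are in [k], so the tails can be rerouted through it. Where [b'] or [a']
    lies on an old tail, that tail is cut there; where one lies on [D], a new arc is chosen;
    otherwise [b'] reaches [A] through [a'] and [a], at the cost of 2. *)
Lemma good_step a b b' a' : adj a b -> adj b b' -> adj b' a' -> adj a' a ->
  a != b' -> b != a' -> good a b -> good b b'.
Proof.
move=> eab ebb' eb'a' ea'a nab' nba' [kab [A [B [l [tA tB U al /andP[o le]]]]]].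
have kbb' : k b b' := k_square eab ebb' eb'a' ea'a nab' nba' kab.
have kb'a' : k b' a'.
  by apply: (k_square (a := b) (b := b') (b' := a') (a' := a)); rewrite // eq_sym.
have ka'a : k a' a.
  by apply: (k_square (a := b') (b := a') (b' := a) (a' := b)); rewrite // eq_sym.
have kba : k b a by rewrite k_sym.
have kb'b : k b' b by rewrite k_sym.
have pA : path k a A by case/and3P: tA.
have pB : path k b B by case/and3P: tB.
have xD : last a A \in D by case/and3P: tA.
have yD : last b B \in D by case/and3P: tB.
have bb' : b != b' by apply: contraTneq ebb' => ->; rewrite adj_irrefl.
have a'a : a' != a by apply: contraTneq ea'a => ->; rewrite adj_irrefl.
have b'a' : b' != a' by apply: contraTneq eb'a' => ->; rewrite adj_irrefl.
have al' := arc_sym al.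
have nAB z : z \in a :: A -> z \in b :: B -> False.
  move: U; rewrite -cat_cons cat_uniq => /and3P[_ /hasPn h _] zA zB.
  by have := h _ zB; rewrite zA.
case: (boolP (b' \in B)) => [b'B|b'B].
  have bD : b \notin D by apply: tail_head tB _; apply: contraTneq b'B => ->.
  have [B1 [B2 EB]] := mem_split b'B.
  move: tB U al o le pB; rewrite EB last_cat => tB U al o le pB.
  apply: (good_same o le kbb' (tail_cons bD kba tA) (tail_split tB) _ al).
    apply: uniq_count U _ => P; do !rewrite /= ?count_cat; clear; lia.
  have := split_cycle pB kb'b; rewrite !size_cat /= .
  by clear -n_odd; case: eqP; lia.
case: (boolP (b' \in A)) => [b'A|b'A].
  have [A1 [A2 EA]] := mem_split b'A.
  move: tA U al al' o le pA; rewrite EA last_cat => tA U al al' o le pA.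
  apply: (good_same o le kbb' tB (tail_split tA) _ al').
    apply: uniq_count U _ => P; do !rewrite /= ?count_cat; clear; lia.
  have := @split_cycle b b' (a :: A1) A2; rewrite /= kba => /(_ pA kb'b).
  by rewrite !size_cat /=; clear -n_odd; case: eqP; lia.
have b'bB : b' \notin b :: B by rewrite inE eq_sym negb_or bb'.
have b'aA : b' \notin a :: A by rewrite inE eq_sym negb_or nab'.
case: (boolP (b' \in D)) => b'D.
  (* With both [b] and [b'] on [D], the even arc between them and the edge [bb'] have total length
     at most [n]. *)
  have [EB|B0] := eqVneq B [::].
    have bD : b \in D by move: yD; rewrite EB.
    have [l1 al1 ol1] : exists2 l1, arc b b' l1 & ~~ odd l1.
      have [l1 al1] := arc_exists bD b'D bb'; have b1 := arc_bounds al1.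
      have [ol|ol] := boolP (odd l1); last by exists l1.
      exists (n - l1); first exact: arc_compl.
      by case/andP: b1 => _ /ltnW b1; rewrite oddB // n_odd ol.
    have b1 := arc_bounds al1.
    apply: (@good_intro b b' [::] [::] l1) => //; rewrite /tail /= ?bD ?b'D //.
      by rewrite inE bb'.
    by clear -b1 n_le; lia.
  have bD := tail_head tB B0.
  have tb' : tail b' [::] by rewrite /tail /= b'D.
  have xy : last a A != last b B.
    by apply/eqP => e; apply: (nAB (last a A)); rewrite ?mem_last // e mem_last.
  have yz : last b B != b' by apply: contraNneq b'bB => <-; apply: mem_last.
  have xz : last a A != b' by apply: contraNneq b'aA => <-; apply: mem_last.
  (* If an arc between two of the three ends has the wrong parity, the complementary
     arc has the right one, or the closed walk through the first one is odd and so
     has length at least [n]. *)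
  have [X [Y [Z [sn aX aY aZ]]]] := arc3 xD yD b'D xy yz xz.
  have [bX [bY bZ]] := (arc_bounds aX, (arc_bounds aY, arc_bounds aZ)).
  have lZ : l = Z \/ l = X + Y by case: (arc_uniq aZ al); clear -sn; lia.
  have w1 := @arc_odd_walk b' (b :: a :: A).
  have w2 := @arc_odd_walk b' (b :: B).
  move: w1 w2; rewrite /= kb'b kba => w1 w2.
  have {}w1 l1 := w1 l1 pA. have {}w2 l1 := w2 l1 pB.
  have U1 : uniq (b :: (a :: A) ++ [:: b']).
    apply: (@uniq_count _ (b' :: a :: A ++ b :: B)).
      by rewrite cons_uniq U -cat_cons mem_cat (negPf b'aA) (negPf b'bB).
    move=> P; do !rewrite /= ?count_cat; clear; lia.
  have U2 : uniq (b :: B ++ [:: b']).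
    apply: (@uniq_count _ (b' :: a :: A ++ b :: B)).
      by rewrite cons_uniq U -cat_cons mem_cat (negPf b'aA) (negPf b'bB).
    move=> P; do !rewrite /= ?count_cat; clear; lia.
  have g1 l1 := @good_intro b b' (a :: A) [::] l1 kbb' (tail_cons bD kba tA) tb' U1.
  have g2 l1 := @good_intro b b' B [::] l1 kbb' tB tb' U2.
  have {w1}dY := w1 _ (arc_sym aY).
  have dX' := w2 _ (arc_sym (arc_compl aX)); have {w2}dX := w2 _ (arc_sym aX).
  have {g2}gX := g2 _ aX; have gY' := g1 _ (arc_compl aY).
  have {g1}gY := g1 _ aY.
  clear -o le lZ n_odd sn bX bY bZ n_le dX dY dX' gX gY gY'.
  move: dX dY dX' gX gY gY' => /=; move: (size A) (size B) o le => p q o le.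
  move=> dX dY dX' gX gY gY'.
  have [oX|oX] := boolP (odd (q.+1 + X)); have [oY|oY] := boolP (odd (p.+2 + Y)).
  - apply: gY; first by move: oY; clear; lia.
    have {dX dY dX'} := dX oX; case: lZ => lZ; lia.
  - apply: gX; first by move: oX; clear; lia.
    clear dX dY dX'; case: lZ => lZ; lia.
  - apply: gY; first by move: oY; clear; lia.
    clear dX dY dX'; case: lZ => lZ; lia.
  - have {dX'} dX' : n <= q.+1 + (n - X) by apply: dX'; clear dX dY; lia.
    clear dX dY gY gX; apply: gY'; [lia|case: lZ; lia].
case: (boolP (a' \in A)) => [a'A|a'A].
  have [A1 [A2 EA]] := mem_split a'A.
  move: tA U al al' o le pA; rewrite EA last_cat => tA U al al' o le pA.
  have tb' := tail_cons b'D kb'a' (tail_split tA).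
  apply: (good_same o le kbb' tB tb' _ al').
    apply: (@uniq_count _ (b' :: a :: A ++ b :: B)).
      by rewrite EA cons_uniq U -cat_cons mem_cat -EA (negPf b'aA) (negPf b'bB).
    move=> P; rewrite EA; do !rewrite /= ?count_cat; clear; lia.
  have := split_cycle pA ka'a; rewrite !size_cat /=.
  by clear -n_odd; case: eqP; lia.
case: (boolP (a' \in B)) => [a'B|a'B].
  have bD : b \notin D by apply: tail_head tB _; apply: contraTneq a'B => ->.
  have [B1 [B2 EB]] := mem_split a'B.
  move: tB U al al' o le pB; rewrite EB last_cat => tB U al al' o le pB.
  have tb' := tail_cons b'D kb'a' (tail_split tB).
  apply: (good_same o le kbb' (tail_cons bD kba tA) tb' _ al).
    apply: (@uniq_count _ (b' :: a :: A ++ b :: B)).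
      by rewrite EB cons_uniq U -cat_cons mem_cat -EB (negPf b'aA) (negPf b'bB).
    move=> P; rewrite EB; do !rewrite /= ?count_cat; clear; lia.
  have := @split_cycle a a' (b :: B1) B2; rewrite /= kab => /(_ pB ka'a).
  by rewrite !size_cat /=; clear -n_odd; case: eqP; lia.
have a'bB : a' \notin b :: B by rewrite inE eq_sym negb_or nba'.
have a'aA : a' \notin a :: A by rewrite inE negb_or a'a.
have U2 : uniq [:: b', a', a & A ++ b :: B].
  have nin z : z \notin a :: A -> z \notin b :: B -> z \notin a :: A ++ b :: B.
    by move=> zA zB; rewrite -cat_cons mem_cat negb_or zA.
  apply/and3P; split; [|exact: nin|exact: U].
  by rewrite in_cons negb_or b'a' nin.
have [a'D|a'D] := boolP (a' \in D); last first.
  have tb' := tail_cons b'D kb'a' (tail_cons a'D ka'a tA).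
  apply: (good_same o le kbb' tB tb' _ al').
    by apply: uniq_count U2 _ => P; do !rewrite /= ?count_cat; clear; lia.
  rewrite /=; clear; case: eqP; lia.
have tb' : tail b' [:: a'] by rewrite /tail /= kb'a' b'D a'D.
have xy : last a A != last b B.
  by apply/eqP => e; apply: (nAB (last a A)); rewrite ?mem_last // e mem_last.
have yz : last b B != a' by apply: contraNneq a'bB => <-; apply: mem_last.
have xz : last a A != a' by apply: contraNneq a'aA => <-; apply: mem_last.
have [X [Y [Z [sn aX aY aZ]]]] := arc3 xD yD a'D xy yz xz.
have [bX [bY bZ]] := (arc_bounds aX, (arc_bounds aY, arc_bounds aZ)).
have lZ : l = Z \/ l = X + Y by case: (arc_uniq aZ al); clear -sn; lia.
have w1 := @arc_odd_walk a' (a :: A).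
move: w1; rewrite /= ka'a => w1.
have {}w1 l1 := w1 l1 pA.
have U1 : uniq (b :: B ++ [:: b'; a']).
  by apply: uniq_count U2 _ => P; do !rewrite /= ?count_cat; clear; lia.
have g l1 := @good_intro b b' B [:: a'] l1 kbb' tB tb' U1.
have dY' := w1 _ (arc_sym (arc_compl aY)); have {w1}dY := w1 _ (arc_sym aY).
have gX' := g _ (arc_compl aX); have {g}gX := g _ aX.
clear -o le lZ n_odd sn bX bY bZ n_le dY dY' gX gX'.
move: dY dY' gX gX' => /=; move: (size A) (size B) o le => p q o le.
move=> dY dY' gX gX'.
have [oX|oX] := boolP (odd (q + X)); have [oY|oY] := boolP (odd (p.+1 + Y)).
- have {dY dY'} dY := dY oY; apply: gX; first by move: oX; clear; lia.
  case: lZ => lZ; lia.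
- apply: gX; first by move: oX; clear; lia.
  clear dY dY'; case: lZ => lZ; lia.
- have {dY dY'} dY := dY oY; clear gX; apply: gX'; first by clear dY; lia.
  case: lZ => lZ; lia.
- have {dY dY'} dY' : n <= p.+1 + (n - Y) by apply: dY'; clear dY; lia.
  clear gX; apply: gX'; [lia|case: lZ; lia].
Qed.
Hypothesis k_ind : forall P : H -> H -> Prop, P (d 0) (d 1) ->
  (forall a b, P a b -> P b a) ->
  (forall a b b' a', adj a b -> adj b b' -> adj b' a' -> adj a' a ->
     a != b' -> b != a' -> P a b -> P b b') ->
  forall a b, k a b -> P a b.

Lemma n_gt2 : 2 < n.
Proof.
case: n n_odd d_per => [|[|[|m]]] //= _ per1.
by have /k_adj := d_path 0; rewrite -[1]add0n per1 adj_irrefl.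
Qed.

Lemma good_all a b : k a b -> good a b.
Proof.
move: a b; apply: k_ind; [|exact: good_sym|exact: good_step].
(* The initial closed walk is [D] itself: an edge, empty tails and the arc of length [n - 1]. *)
split=> //; exists [::], [::], (n - 1).
split; rewrite /tail /= ?mem_d ?inE //.
- rewrite andbT; apply: contraTneq (d_path 0) => ->.
  by apply/negP => /k_adj; rewrite adj_irrefl.
- apply: arc_compl; left; exists 0; split=> //; exact: ltn_trans n_gt2.
- by have := n_gt2; move: n_odd n_le; clear; lia.
Qed.

(** The two tails have at most [2r-3] edges together, so one has at most [r-2]; if it starts at [b],
    the edge [ab] is put in front. *)
Lemma confinement a b : k a b ->
  exists p, [/\ path (@adj H) a p, last a p \in D & size p <= r - 1].
Proof.
move=> /good_all[kab [A [B [l [tA tB _ al /andP[_ le]]]]]].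
have {al} l0 : 0 < l by case/andP: (arc_bounds al).
have [pA xD] : path (@adj H) a A /\ last a A \in D.
  by case/and3P: tA => /(sub_path k_adj).
have [pB yD] : path (@adj H) b B /\ last b B \in D.
  by case/and3P: tB => /(sub_path k_adj).
have [sA|sA] := leqP (size A) (r - 1); first by exists A.
exists (b :: B); split; rewrite //= ?k_adj //.
by move: sA le l0; clear; lia.
Qed.

End Confinement.

(** * Coloring spheres *)

Definition simple_path (T : eqType) (e : rel T) x y n :=
  exists p, [/\ path e x p, last x p = y, uniq (x :: p) & size p = n].

Lemma simple_path_sub (T : finType) (e e' : rel T) x y n :
  subrel e e' -> simple_path e x y n -> simple_path e' x y n.
Proof. by move=> sub [p [P L U S]]; exists p; split=> //; apply: sub_path P. Qed.

Section DepthFirst.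
Variables (T : finType) (e : rel T).
Hypotheses (e_sym : symmetric e) (e_irr : irreflexive e).

Definition rst (S : {set T}) := [rel x y | [&& e x y, x \in S & y \in S]].

Lemma connect_rst_sym S : connect_sym (rst S).
Proof.
apply: sym_connect_sym => x y /=.
by rewrite e_sym; case: (x \in S); case: (y \in S).
Qed.

(* Depth in a depth-first search tree: adjacent vertices are joined along the
   tree by a path whose length is the difference of their depths. *)
Lemma depth_exists (S : {set T}) v : v \in S -> exists f : T -> nat,
  [/\ f v = 0, forall w, connect (rst S) v w -> simple_path (rst S) v w (f w) &
      forall u w, connect (rst S) v u -> rst S u w ->
        f u < f w /\ simple_path (rst S) u w (f w - f u) \/
        f w < f u /\ simple_path (rst S) w u (f u - f w)].
Proof.
have [n] := ubnP #|S|; elim: n S v => // n IH S v leS vS.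
pose S' := S :\ v.
have subS : subrel (rst S') (rst S).
  by move=> x y /= /and3P[-> /setD1P[_ ->] /setD1P[_ ->]].
have allS' x p : x \in S' -> path (rst S') x p -> all [in S'] (x :: p).
  elim: p x => /= [|y p IHp] x ->; rewrite ?andbT //.
  by case/andP=> /and3P[_ _ yS] yp; rewrite (IHp y) ?yS.
have /choice[F FP] : forall y, exists f : T -> nat, y \in S' ->
   [/\ f y = 0, forall w, connect (rst S') y w -> simple_path (rst S') y w (f w) &
      forall u w, connect (rst S') y u -> rst S' u w ->
        f u < f w /\ simple_path (rst S') u w (f w - f u) \/
        f w < f u /\ simple_path (rst S') w u (f u - f w)].
  move=> y; have [yS|yS] := boolP (y \in S'); last by exists (fun=> 0).
  have [|f fP] := IH S' y _ yS; last by exists f.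
  by move: leS; rewrite (cardsD1 v S) vS.
(* [nu w] is the child of [v] whose subtree contains [w]. It depends only on the component of [w] in
   [S'], so adjacent vertices of [S'] share a subtree. The default occurs only at [v] and at
   unreachable vertices. *)
pose nu w := odflt v [pick y | [&& e v y, y \in S' & connect (rst S') y w]].
have nuP w : connect (rst S) v w -> w != v ->
    [&& e v (nu w), nu w \in S' & connect (rst S') (nu w) w].
  move=> /connectP[p pP ->].
  case/shortenP: pP => {}p pP U _ ne; rewrite /nu; case: pickP => //=.
  case: p pP U ne => [|y p] /=; first by rewrite eqxx.
  case/andP=> /and3P[vy _ yS] pP /andP[vp _] ne.
  move=> /(_ y); rewrite vy in_setD1 yS andbT.
  have -> : y != v by apply: contra vp => /eqP ->; apply: mem_head.
  rewrite /= => /negP[]; apply/connectP; exists p => //.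
  have : all (predC1 v) (y :: p) by apply/allP => z zp /=; apply: contraNneq vp => <-.
  elim: p y pP {vy yS vp ne} => //= z p IHp y /andP[/and3P[yz yS zS] zp].
  by move=> /and3P[yv zv pv]; rewrite yz !in_setD1 yv zv yS zS IHp //= zv.
have nu_simple w : connect (rst S) v w -> w != v ->
    simple_path (rst S) v w (F (nu w) w).+1.
  move=> vw wv; have /and3P[vn nS nw] := nuP w vw wv.
  have [_ /(_ w nw)[p [P L U Sp]] _] := FP _ nS; exists (nu w :: p); split=> //=.
  - by rewrite vn vS (sub_path subS P) andbT; case/setD1P: nS.
  - have /allP a := allS' _ _ nS P; apply/andP; split=> //.
    by apply/negP => /a; rewrite /= !inE eqxx.
  - by rewrite Sp.
exists (fun w => if w == v then 0 else (F (nu w) w).+1); rewrite eqxx; split=> //.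
  move=> w vw; have [->|wv] := eqVneq w v; [by exists [::]|exact: nu_simple].
move=> u w vu uw.
have vw : connect (rst S) v w by apply: connect_trans vu _; apply: connect1.
have ne : u != w by apply: contraTneq uw => -> /=; rewrite e_irr.
have wu : rst S w u by move: uw; rewrite /= e_sym => /and3P[-> -> ->].
have [uv|uv] := eqVneq u v.
  have wv : w != v by rewrite -uv eq_sym.
  by left; rewrite (negPf wv) uv; split=> //; apply: nu_simple.
have [wv|wv] := eqVneq w v; first by right; split=> //; rewrite wv; apply: nu_simple.
have uw' : rst S' u w.
  by case/and3P: uw => uw uS wS; rewrite /= uw !in_setD1 uv wv uS wS.
have -> : nu w = nu u.
  congr odflt; apply: eq_pick => y /=; congr [&& _, _ & _].
  exact/esym/(same_connect_r (connect_rst_sym S'))/connect1.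
have /and3P[_ nS nu_u] := nuP u vu uv.
have [_ _ /(_ u w nu_u uw')] := FP _ nS.
by case=> -[lt sp]; [left|right]; rewrite ltnS lt subSS; split=> //;
  apply: simple_path_sub sp.
Qed.

Lemma depth_exists_setT v : exists f : T -> nat,
  forall u w, connect e v u -> e u w ->
    f u < f w /\ simple_path e u w (f w - f u) \/
    f w < f u /\ simple_path e w u (f u - f w).
Proof.
have [f [_ _ fP]] := depth_exists (in_setT v).
have E : rst setT =2 e by move=> x y /=; rewrite !inE !andbT.
exists f => u w vu uw; have sub : subrel (rst setT) e by move=> x y; rewrite E.
case: (fP u w); [by rewrite (eq_connect E)|by rewrite /= !inE uw| |].
  by case=> lt sp; left; split=> //; apply: simple_path_sub sp.
by case=> lt sp; right; split=> //; apply: simple_path_sub sp.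
Qed.
End DepthFirst.

(** * Labels that agree at the ends of simple paths of a fixed length *)

Section LabelledComponent.
Variables (T : finType) (e : rel T) (v0 : T) (lab : T -> bool) (l : nat).
Hypotheses (e_sym : symmetric e) (e_irr : irreflexive e) (l_gt0 : 0 < l).
Hypothesis no_path : forall x p, connect e v0 x -> path e x p -> uniq (x :: p) ->
  size p = l -> lab x = lab (last x p).

Lemma label_of_long_path s1 y s2 : connect e v0 y -> size s2 = l ->
  sorted e (s1 ++ y :: s2) -> uniq (s1 ++ y :: s2) -> lab y = lab (last y s2).
Proof.
move=> vy sz; rewrite cat_uniq => S /and3P[_ _ U]; apply: no_path => //.
by move: S; case: s1 => [|z s1] //=; rewrite cat_path /= => /and3P[].
Qed.

(* Labels agree at distance [l] along a cycle of length [q * l + 1], hence at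
   consecutive vertices. *)
Lemma cycle_label_ends x p q : connect e v0 x -> ucycle e (x :: p) ->
  size p = q * l -> lab x = lab (last x p).
Proof.
move=> vx /andP[cyc U] sz; have P : path e x p by move: cyc; rewrite /= rcons_path => /andP[].
elim: q x p vx P U sz {cyc} => [|q IH] x p vx P U sz.
  by move: sz; rewrite mul0n => /size0nil ->.
have sl : size (take l p) = l by rewrite size_takel // sz mulSn leq_addr.
have := P; rewrite -{1}(cat_take_drop l p) cat_path => /andP[P1 P2].
have := U; rewrite -{1}(cat_take_drop l p) -cat_cons cat_uniq => /and3P[U1 hd U2].
have -> : last x p = last (last x (take l p)) (drop l p).
  by rewrite -last_cat cat_take_drop.
rewrite (no_path vx P1 U1 sl); apply: IH => //.
- by apply: connect_trans vx _; apply/connectP; exists (take l p).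
- rewrite cons_uniq U2 andbT; apply: contra hd => lp; apply/hasP.
  by exists (last x (take l p)) => //; apply: mem_last.
- by rewrite size_drop sz mulSn addKn.
Qed.

(** Rotating the cycle shows that it carries one label, and no other label can then occur in the
    component. *)
Lemma no_long_cycle a x p q : ucycle e (x :: p) -> connect e v0 x ->
  0 < q -> size p = q * l -> connect e v0 a -> lab a = lab x.
Proof.
move=> cyc vx q0 sz va; apply/eqP/negPn/negP => ne.
have conn z : z \in x :: p -> connect e v0 z.
  move=> zc; apply: connect_trans vx _; apply: (path_connect (p := p)) zc.
  by case/andP: cyc; rewrite /= rcons_path => /andP[].
have step i : i.+1 < size (x :: p) ->
    lab (nth x (x :: p) i) = lab (nth x (x :: p) i.+1).
  move=> lt; set c := x :: p in lt *; have lt' : i < size c by apply: ltnW.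
  have E : rot i.+1 c = nth x c i.+1 :: (drop i.+2 c ++ take i.+1 c).
    by rewrite /rot (drop_nth x lt).
  have := @cycle_label_ends (nth x c i.+1) (drop i.+2 c ++ take i.+1 c) q.
  rewrite -E rot_ucycle last_cat (take_nth x lt') last_rcons => -> //.
    exact: conn (mem_nth x lt).
  have := size_rot i.+1 c; have -> : size c = (q * l).+1 by rewrite /= sz.
  by rewrite E (take_nth x lt') => -[].
have labc z : z \in x :: p -> lab z = lab x.
  move=> /(nthP x)[i lt <-]; elim: i lt => // i IHi lt.
  by rewrite -step // IHi // ltnW.
(* A shortest path from the cycle to another label, preceded by a long stretch of
   the cycle, ends with a path of length [l] violating [no_path]. *)
pose far n := `[< exists z s, [/\ z \in x :: p, path e z s, lab (last z s) != lab x
  & size s = n] >].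
have exfar : exists n, far n.
  have /connectP[s sP Ea] : connect e x a.
    by rewrite (same_connect (sym_connect_sym e_sym) (y := v0)) // 
       (sym_connect_sym e_sym).
  by exists (size s); apply/asboolP; exists x, s; rewrite mem_head -Ea.
case: (ex_minnP exfar) => n /asboolP[z [s [zc zs ls <-]]] nmin {n exfar}.
have {}nmin z' s' : z' \in x :: p -> path e z' s' -> lab (last z' s') != lab x ->
    size s <= size s'.
  by move=> *; apply: nmin; apply/asboolP; exists z', s'.
move: ls nmin; case/shortenP: zs => s' zs' Us' /uniq_leq_size sz' ls nmin.
have {sz'} sz' : size s' <= size s by apply: sz'; case/andP: Us'.
have {sz'} nmin z' s1 : z' \in x :: p -> path e z' s1 -> lab (last z' s1) != lab x ->
    size s' <= size s1.
  by move=> a1 a2 a3; apply: leq_trans sz' _; apply: nmin a1 a2 a3.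
have s'off y : y \in s' -> y \notin x :: p.
  move=> ys; apply/negP => yc; case/path.splitPr: ys zs' ls nmin {Us'} => s1 s2.
  rewrite cat_path last_cat /= => /and3P[_ _ yP] ly nmin.
  by have := nmin _ _ yc yP ly; rewrite size_cat /= addnS ltnNge leq_addl.
have s'lab s1 y s2 : s' = s1 ++ y :: s2 -> lab y != lab x -> s2 = [::].
  move=> E ly; have := nmin z (s1 ++ [:: y]) zc; rewrite last_cat /= ly.
  move: zs'; rewrite E !cat_path /= => /and3P[-> -> _] /(_ erefl erefl).
  by rewrite !size_cat /= leq_add2l ltnS leqn0 => /eqP/size0nil.
case/rot_to: (zc) => i c Ec.
have [c' Ec'] : exists c', ucycle e (rcons c' z) /\ rcons c' z =i x :: p /\ size c' = size p.
  exists c; rewrite -rot1_cons -Ec !rot_ucycle; split=> //; split.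
    by move=> y; rewrite !mem_rot.
  by have := size_rot i (x :: p); rewrite Ec => -[].
case: Ec' => /andP[cyc' U'] [memc' szc'].
have S : sorted e (c' ++ z :: s').
  case: (c') cyc' => [|y c''] /=; first by rewrite zs'.
  by rewrite rcons_path cat_path /= rcons_path => /andP[/andP[-> ->] _].
have U : uniq (c' ++ z :: s').
  have us' : uniq s' by case/andP: Us'.
  rewrite -cat_rcons cat_uniq U' us' andbT.
  by apply/hasPn => y /s'off /=; rewrite memc'.
have s0 : s' != [::] by apply: contraNneq ls => -> /=; rewrite labc.
pose t := c' ++ z :: s'.
have szt : l < size t.
  by rewrite size_cat szc' sz /= addnS ltnS (leq_trans (leq_pmull l q0)) ?leq_addr.
(* The last [l.+1] vertices of [t] form a simple path of length [l]. It starts on the cycle or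
   inside [s'], where the label is still that of [x], and ends at the other label. *)
pose j := size t - l.+1.
have ltj : j < size t by rewrite ltn_subrL; case: (size t) szt.
have Et : t = take j t ++ nth x t j :: drop j.+1 t by rewrite -drop_nth // cat_take_drop.
have lastt : last (nth x t j) (drop j.+1 t) = last z s'.
  by have := congr1 (last x) Et; rewrite !last_cat /=.
have := label_of_long_path (s1 := take j t) (y := nth x t j) (s2 := drop j.+1 t).
rewrite -Et lastt size_drop => /(_ _ _ S U) H.
have vy : connect e v0 (nth x t j).
  have : nth x t j \in t by apply: mem_nth.
  rewrite mem_cat => /orP[yc|ys].
    by apply: conn; rewrite -memc' mem_rcons inE yc orbT.
  exact: connect_trans (conn _ zc) (path_connect zs' ys).
move/eqP: ls; apply; rewrite -H //; last first.
  by rewrite /j; move: (size t) szt; clear; lia.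
rewrite /t -cat_rcons nth_cat size_rcons; case: ltnP => lt.
  by apply/labc; rewrite -memc' mem_nth // size_rcons.
apply/eqP/negPn/negP => ly.
set i' := j - _ in ly; have lti' : i'.+1 < size s'.
  move: lt szt; rewrite /i' /j /t size_cat /=; move: (size c') (size s').
  by clear -l_gt0; lia.
have := @s'lab (take i' s') (nth x s' i') (drop i'.+1 s').
rewrite -drop_nth ?cat_take_drop ?(ltnW lti') // => /(_ erefl ly) /(congr1 size)/eqP.
by rewrite size_drop subn_eq0 leqNgt lti'.
Qed.

(** Vertices are colored by depth modulo [l]. A monochromatic edge would close a tree path to a
    cycle of length [q * l + 1], leaving only one label in the component. *)
Lemma no_path_coloring : (exists a b, [/\ connect e v0 a, connect e v0 b
    & lab a != lab b]) ->
  exists f : T -> nat, (forall u, f u < l) /\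
    forall u w, connect e v0 u -> e u w -> f u != f w.
Proof.
case=> a [b [va vb ab]].
have [f fP] := depth_exists_setT e_sym e_irr v0.
exists (fun u => f u %% l); split=> [u|u w vu uw]; first by rewrite ltn_mod.
apply/eqP => fuw.
have key x y q : connect e v0 x -> e y x -> simple_path e x y q -> 0 < q ->
    l %| q -> False.
  move=> vx yx [p [P L U sz]] q0 /dvdnP[q' Eq].
  have q'0 : 0 < q' by case: q' Eq q0 => // ->.
  have C : ucycle e (x :: p) by rewrite /ucycle /= rcons_path P L yx -cons_uniq.
  have szp : size p = q' * l by rewrite sz.
  by move/eqP: ab; apply; rewrite !(no_long_cycle C vx q'0 szp).
have vw : connect e v0 w by apply: connect_trans vu (connect1 uw).
case: (fP u w vu uw) => -[lt sp].
  apply: key vu _ sp _ _; [by rewrite e_sym|by rewrite subn_gt0|].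
  by rewrite -eqn_mod_dvd ?(ltnW lt) // fuw.
apply: key vw uw sp _ _; first by rewrite subn_gt0.
by rewrite -eqn_mod_dvd ?(ltnW lt) // fuw.
Qed.
End LabelledComponent.

(** * Spheres in graphs without cycles of length [2r+1] *)

Section Sphere.
Variables (H : sgraph) (r : nat) (lev : H -> nat) (par : H -> H) (i : nat).
Hypotheses (H_free : cycle_free (2 * r + 1) H) (i_lt : i < r).
Hypothesis lev0 : forall u v, lev u = 0 -> lev v = 0 -> u = v.
Hypothesis parP : forall v j, lev v = j.+1 -> j.+1 < r ->
  adj v (par v) /\ lev (par v) = j.

Lemma lev_iter u j : lev u = i -> j <= i -> lev (iter j par u) = i - j.
Proof.
move=> lu; elim: j => [|j IH] ji; first by rewrite subn0.
have lj := IH (ltnW ji).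
have [|| //] := @parP (iter j par u) (i - j.+1); last by rewrite /=; lia.
  by rewrite lj; lia.
Qed.

Lemma adj_iter u j : lev u = i -> j < i -> adj (iter j par u) (iter j.+1 par u).
Proof.
move=> lu ji; have lj := lev_iter lu (ltnW ji).
by have [||//] := @parP (iter j par u) (i - j.+1); lia.
Qed.

Lemma sorted_traject u n : lev u = i -> n <= i.+1 -> sorted (@adj H) (traject par u n).
Proof.
move=> lu; case: n => // n ni; rewrite /=.
elim: n ni => // n IH ni; rewrite trajectSr rcons_path IH 1?ltnW //=.
by rewrite last_traject -iterSr; apply: adj_iter.
Qed.

Lemma uniq_traject u n : lev u = i -> n <= i.+1 -> uniq (traject par u n).
Proof.
move=> lu; elim: n => // n IH ni; rewrite trajectSr rcons_uniq IH 1?ltnW // andbT.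
apply/trajectP => -[j jn /(congr1 lev)]; rewrite !lev_iter //; lia.
Qed.

Definition sphere_adj := [rel u w | [&& adj u w, lev u == i & lev w == i]].

Lemma sphere_connect u w : lev u = i -> connect sphere_adj u w -> lev w = i.
Proof.
move=> lu /connectP[p pP ->]; elim: p u lu pP => //= v p IH u lu.
by case/andP=> /and3P[_ _ /eqP lv]; apply: IH.
Qed.

Lemma sphere_adj_sym : symmetric sphere_adj.
Proof. by move=> u w /=; rewrite adj_sym [(lev u == i) && _]andbC. Qed.

(* Otherwise [p] and the two tree paths to the common ancestor of its ends form a
   cycle of length [2r+1]. *)
Lemma sphere_path_label x p h : lev x = i -> path sphere_adj x p ->
  uniq (x :: p) -> h < i -> iter h.+1 par x = iter h.+1 par (last x p) ->
  size p = 2 * r + 1 - 2 * h.+1 -> iter h par x = iter h par (last x p).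
Proof.
move=> lx pP U hi E sz; apply/eqP/negPn/negP => ne.
set w := last x p in E ne.
have allp : all (fun y => lev y == i) (x :: p).
  apply/allP => y yp; apply/eqP/(sphere_connect lx).
  exact: path_connect pP _ yp.
have lw : lev w = i by apply/eqP/(allP allp)/mem_last.
(* From [w] the cycle climbs to the common ancestor and then descends to [par x]. *)
pose c := (x :: p) ++ traject par (par w) h.+1 ++ rev (traject par (par x) h).
have szc : size c = 2 * r + 1.
  by rewrite /c !size_cat size_rev !size_traject /= sz; lia.
apply: (H_free (c := c)) szc; split; last first.
  by rewrite /c !size_cat size_rev !size_traject /= sz; lia.
apply/andP; split.
  have S1 : path (@adj H) w (traject par (par w) h.+1).
    exact: (sorted_traject (n := h.+2) lw).
  have S2 : path (@adj H) (iter h.+1 par x) (rev (traject par x h.+1)).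
    have := sorted_traject (n := h.+2) lx; rewrite trajectSr => /(_ hi).
    rewrite -rev_sorted rev_rcons /=.
    by apply: sub_path => u v; rewrite adj_sym.
  have Ec : rcons (p ++ traject par (par w) h.+1 ++ rev (traject par (par x) h)) x
      = p ++ traject par (par w) h.+1 ++ rev (traject par x h.+1).
    by rewrite !rcons_cat /= rev_cons.
  suff : path (@adj H) x
      (p ++ traject par (par w) h.+1 ++ rev (traject par x h.+1)) by rewrite -Ec.
  rewrite !cat_path -/w S1 last_traject -E S2 !andbT.
  by apply: sub_path pP => u v /and3P[].
have uw : uniq (traject par (par w) h.+1).
  by have /andP[] := uniq_traject (n := h.+2) lw hi.
have ux : uniq (traject par (par x) h).
  by have /andP[] := uniq_traject (n := h.+1) lx (ltnW hi).
have up u n y : y \in traject par (par u) n ->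
    exists2 j, 0 < j <= n & y = iter j par u.
  by move=> /trajectP[j jn ->]; exists j.+1; rewrite ?iterSr.
rewrite /c cat_uniq U [uniq (_ ++ _)]cat_uniq rev_uniq uw ux andbT.
apply/and3P; split=> //.
  apply/hasPn => y; rewrite mem_cat mem_rev => yt; apply/negP => /(allP allp)/eqP.
  by case/orP: yt => /up[j /andP[j0 jh] ->]; rewrite lev_iter //;
    move: j0 jh hi; clear; lia.
apply/hasPn => y; rewrite mem_rev => /up[j /andP[j0 jh] ->].
apply/negP => /up[j' /andP[j'0 j'h] e].
(* A common vertex of the two tree paths has the same height on both, and from there on the
   ancestors agree, up to height [h]. *)
have jj' : j = j'.
  by have := congr1 lev e; rewrite !lev_iter //; move: j'h jh hi; clear; lia.
by move/eqP: ne; apply; rewrite -(subnK jh) !iterD e jj'.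
Qed.

(** In each component, take the least height at which all vertices have the same ancestor, and label
    a vertex by whether its ancestor one step lower is that of [v0]. By minimality both labels
    occur, and [no_path_coloring] applies. *)
Lemma sphere_coloring : 1 < r -> exists f : H -> nat, (forall u, f u < 2 * r - 1) /\
  forall u w, lev u = i -> lev w = i -> adj u w -> f u != f w.
Proof.
move=> r_gt1.
have irr : irreflexive sphere_adj by move=> x; rewrite /= adj_irrefl.
have comp v0 : exists f : H -> nat, lev v0 = i -> (forall u, f u < 2 * r - 1) /\
    forall u w, connect sphere_adj v0 u -> sphere_adj u w -> f u != f w.
  have [lv0|/eqP ne] := eqVneq (lev v0) i; last by exists (fun=> 0).
  pose P h := [forall u, connect sphere_adj v0 u ==> (iter h par u == iter h par v0)].
  have exP : exists h, P h.
    exists i; apply/forallP => u; apply/implyP => vu; apply/eqP/lev0.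
      by rewrite lev_iter ?subnn // (sphere_connect lv0).
    by rewrite lev_iter ?subnn.
  case: (ex_minnP exP) => h /forallP Ph hmin.
  have hi : h <= i.
    apply: hmin; apply/forallP => u; apply/implyP => vu; apply/eqP/lev0.
      by rewrite lev_iter ?subnn // (sphere_connect lv0).
    by rewrite lev_iter ?subnn.
  (* At height 0 the component is the single vertex [v0]. *)
  case: h Ph hmin hi => [|h] Ph hmin hi.
    exists (fun=> 0) => _; split=> [_|u w vu uw]; first by clear -r_gt1; lia.
    have vw := connect_trans vu (@connect1 _ sphere_adj _ _ uw).
    have := Ph u; have := Ph w; rewrite vu vw /= => /eqP <- /eqP uw'.
    by case/andP: uw; rewrite uw' adj_irrefl.
  have : ~~ P h by apply/negP => /hmin; rewrite ltnn.
  case/forallPn => a; rewrite negb_imply => /andP[va ne].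
  have [|||||f [fl fP]] := @no_path_coloring _ sphere_adj v0
      (fun u => iter h par u == iter h par v0) (2 * r + 1 - 2 * h.+1).
  - exact: sphere_adj_sym.
  - exact: irr.
  - by move: hi i_lt; clear; lia.
  - move=> x p vx pP U sz; congr (_ == _).
    apply: (sphere_path_label _ pP U hi _ sz); first exact: sphere_connect vx.
    have vp : connect sphere_adj v0 (last x p).
      exact: connect_trans vx (path_connect pP (mem_last x p)).
    have /implyP/(_ vx)/eqP -> := Ph x.
    by have /implyP/(_ vp)/eqP -> := Ph (last x p).
  - by exists v0, a; rewrite va connect0 eqxx eq_sym eqb_id.
  exists f => _; split=> // u; apply: leq_trans (fl u) _.
  by clear; lia.
have /choice[F FP] := comp.
exists (fun u => if lev u == i then F (root sphere_adj u) u else 0).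
have csym := sym_connect_sym sphere_adj_sym.
have lroot u : lev u = i -> lev (root sphere_adj u) = i.
  by move=> lu; apply: sphere_connect lu (connect_root _ u).
split=> [u|u w lu lw uw].
  case: eqP => [/lroot/FP[]//|_]; first by clear -r_gt1; lia.
rewrite lu lw eqxx.
have suw : sphere_adj u w by rewrite /= uw lu lw eqxx.
rewrite -(rootP csym (@connect1 _ sphere_adj _ _ suw)); apply: (FP _ (lroot _ lu)).2 => //.
by rewrite csym connect_root.
Qed.

End Sphere.

(** * The coloring *)

Lemma chromatic_number_le (G : sgraph) (T : finType) (f : G -> T) :
  (forall u v, adj u v -> f u != f v) -> chromatic_number G <= #|T|.
Proof.
move=> fP; rewrite /chromatic_number; case: ex_minnP => m _; apply.
apply/existsP; exists [ffun x => enum_rank (f x)].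
apply/forallP=> x; apply/forallP=> y; apply/implyP=> xy.
by rewrite !ffunE (inj_eq enum_rank_inj) fP.
Qed.

(** Levels of adjacent vertices in the ball differ by at most 1, so equal parity puts both on one
    sphere, whose coloring separates them. *)
Lemma ball_coloring (H : sgraph) r (x : H) : 1 < r -> cycle_free (2 * r + 1) H ->
  exists (B : pred H) (f : H -> bool * 'I_(2 * r - 1)),
    (forall p, path (@adj H) x p -> size p < r -> B (last x p)) /\
    (forall u v, B u -> B v -> adj u v -> f u != f v).
Proof.
move=> r1 H_free.
pose reach m v := exists p, [/\ path (@adj H) x p, last x p = v & size p = m].
(* The level is the distance from [x] truncated at [r]. *)
have /choice[lev levP] : forall v, exists l,
    (l < r -> reach l v) /\ (forall m, reach m v -> l <= m).
  move=> v; pose P m := (m == r) || `[< reach m v >].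
  have exP : exists m, P m by exists r; rewrite /P eqxx.
  case: (ex_minnP exP) => l Pl lmin; exists l; split.
    by case/orP: Pl => [/eqP ->|/asboolP]; rewrite ?ltnn.
  by move=> m mv; apply: lmin; apply/orP; right; apply/asboolP.
have lev0 u v : lev u = 0 -> lev v = 0 -> u = v.
  move=> u0 v0; have [+ _] := levP u; have [+ _] := levP v; rewrite u0 v0.
  have r0 : 0 < r by apply: ltnW.
  by move=> /(_ r0)[p [_ <- /size0nil ->]] /(_ r0)[q [_ <- /size0nil ->]].
have levS u v : lev u < r -> adj u v -> lev v <= (lev u).+1.
  move=> lu uv; have [/(_ lu)[p [pP pl ps]] _] := levP u.
  have [_] := levP v; apply; exists (rcons p v).
  by rewrite rcons_path pP pl uv last_rcons size_rcons ps.
have /choice[par parP] : forall v, exists u, forall j,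
    lev v = j.+1 -> j.+1 < r -> adj v u /\ lev u = j.
  move=> v; case: (lev v =P 0) => [->|]; first by exists v.
  have [lt|ge] := ltnP (lev v) r; last first.
    by exists v => j lj; rewrite -lj ltnNge ge.
  have [/(_ lt)[p [pP pl ps]] _] := levP v => v0.
  case/lastP: p pP pl ps => [|p w]; first by move=> _ _ /esym.
  rewrite rcons_path last_rcons size_rcons => /andP[pP uw] wv ps; subst w.
  have le : lev (last x p) <= size p by apply: (levP _).2; exists p.
  exists (last x p) => j; rewrite -ps => -[<-] jr; split; first by rewrite adj_sym.
  apply/eqP; rewrite eqn_leq le -ltnS ps; apply: levS uw.
  by apply: leq_ltn_trans le _; apply: ltnW.
have /choice[F FP] : forall i, exists f : H -> 'I_(2 * r - 1), i < r ->
    forall u w, lev u = i -> lev w = i -> adj u w -> f u != f w.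
  have r0 : 0 < 2 * r - 1 by clear -r1; lia.
  move=> i; have [lt|_] := ltnP i r; last by exists (fun=> Ordinal r0).
  have [f [fl fP]] := sphere_coloring H_free lt lev0 parP r1.
  by exists (fun u => Ordinal (fl u)) => _ u w lu lw uw; apply: fP lu lw uw.
exists [pred v | lev v < r], (fun v => (odd (lev v), F (lev v) v)); split.
  by move=> p pP pr; apply: leq_ltn_trans pr; apply: (levP _).2; exists p.
move=> u v /= lu lv uv; apply/eqP => -[od Fuv].
have e : lev u = lev v.
  have := levS _ _ lu uv; have := levS v u lv; rewrite adj_sym uv => /(_ erefl).
  by move: od; move: (lev u) (lev v); clear; lia.
by have := FP _ lv u v e erefl uv; rewrite -{1}e Fuv eqxx.
Qed.

Lemma walk_sum_map (G H : sgraph) (phi : G -> H) (h : rel H) x p :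
  walk_sum (fun u v => h (phi u) (phi v)) x p = walk_sum h (phi x) (map phi p).
Proof. by elim: p x => //= y p IH x; rewrite IH. Qed.

Section Main.
Variables (G H : sgraph) (r : nat) (phi : G -> H).
Hypotheses (r_gt1 : 1 < r) (phi_hom : graph_hom phi).
Hypothesis H_free : cycle_free (2 * r + 1) H.

Lemma chromatic_near_cycle n (d : nat -> H) (k : rel H) (c : G -> bool) :
  n <= 2 * r - 1 ->
  (forall a b, k a b -> exists p,
     [/\ path (@adj H) a p, last a p \in mkseq d n & size p <= r - 1]) ->
  (forall u v, adj u v -> c u = c v -> k (phi u) (phi v)) ->
  chromatic_number G < 8 * r ^ 2.
Proof.
move=> n_le k_near cP.
have /choice[B /choice[f BfP]] : forall a : 'I_n, exists (B : pred H)
    (f : H -> bool * 'I_(2 * r - 1)),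
    (forall p, path (@adj H) (d a) p -> size p < r -> B (last (d a) p)) /\
    (forall u v, B u -> B v -> adj u v -> f u != f v).
  by move=> a; apply: ball_coloring.
pose col u : ('I_n * (bool * 'I_(2 * r - 1))) + bool :=
  if [pick a | B a (phi u)] is Some a then inl (a, f a (phi u)) else inr (c u).
apply: (@leq_ltn_trans #|{: ('I_n * (bool * 'I_(2 * r - 1))) + bool}|).
  apply: (@chromatic_number_le _ _ col) => u v uv; rewrite /col.
  case: pickP => [a Ba|nu]; case: pickP => [b Bb|nv] //.
    apply/eqP => -[ab]; move: Bb; rewrite -ab => Bb; apply/eqP.
    exact: (BfP a).2 Ba Bb (phi_hom uv).
  (* An edge monochromatic for [c] is mapped into [k], so [phi u] is within distance [r-1] of the
     cycle and lies in one of the balls. *)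
  apply/eqP => -[/(cP _ _ uv)/k_near[p [pP /mapP[i]]]].
  rewrite mem_iota /= => li El sp.
  have [q [qP ql qs]] := path_back (@adj_sym H) pP; rewrite El in qP ql qs.
  have := (BfP (Ordinal li)).1 q qP; rewrite ql nu qs => H0.
  suff: false by []; apply: H0; by move: sp r_gt1; clear; lia.
(* The number of colors is at most [2(2r-1)^2 + 2 = 8r^2 - 8r + 4]. *)
rewrite card_sum !card_prod card_bool !card_ord.
by move: n_le r_gt1; rewrite expnS expn1; clear; nia.
Qed.

(** An edge monochromatic for [c] has an end mapped to [v]; the other end is not, as [H] has no
    loops. *)
Lemma chromatic_corner e0 v (c : G -> bool) :
  (forall u w, adj u w -> c u = c w -> corner e0 v (phi u) (phi w)) ->
  chromatic_number G < 8 * r ^ 2.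
Proof.
move=> cP; apply: (@leq_ltn_trans #|{: bool * bool}|).
  apply: (@chromatic_number_le _ _ (fun u => (c u, phi u == v))) => u w uw.
  apply/eqP => -[/(cP _ _ uw)/andP[_ +] e]; rewrite -e orbb => /eqP uv.
  move: e; rewrite uv eqxx => /esym/eqP wv.
  by have := phi_hom uw; rewrite uv wv adj_irrefl.
rewrite card_prod card_bool; move: r_gt1; rewrite expnS expn1; clear; nia.
Qed.

End Main.

Theorem theorem7p3 (G H : sgraph) (v0 : G) (r : nat) (phi : G -> H)
  (G_connected : connected G)
  (pi1_cyclic : is_cyclic (pi1 v0))
  (r_ge2 : 2 <= r)
  (phi_hom : graph_hom phi)
  (H_free : cycle_free (2 * r + 1) H)
  (C : seq G)
  (C_cycle : is_cycle C)
  (C_odd : odd (size C))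
  (C_image : #|[set phi v | v in C]| <= 2 * r + 2) :
  chromatic_number G < 8 * r ^ 2.
Proof.
case: C C_cycle C_odd C_image => // z p [/andP[cyc _] _] C_odd C_image.
have CP : path (@adj G) z (rcons p z) := cyc.
have Cl : last z (rcons p z) = z by rewrite last_rcons.
have Co : odd (size (rcons p z)) by rewrite size_rcons.
pose W := map phi (rcons p z).
have WP : path (@adj H) (phi z) W by apply: homo_path CP => x y; exact: phi_hom.
have Wl : last (phi z) W = phi z by rewrite last_map Cl.
have Wo : odd (size W) by rewrite size_map.
have [|e0 [e0_adj e0W alt]] := odd_closed_walk_class H_free WP Wl Wo.
  apply: leq_trans C_image; apply: subset_leq_card; apply/subsetP => y.
  rewrite !inE => yW; have : y \in map phi (z :: p).
    by move: yW; rewrite /= /W map_rcons mem_rcons !inE; case: (y == phi z).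
  by case/mapP => x xC ->; apply: imset_f.
(* Weights are pulled back along [phi], which maps squares to possibly degenerate squares. *)
have color (h : rel H) : symmetric h -> (forall a x y b, adj a x -> adj x b ->
      adj a y -> adj y b -> h a x (+) h x b = h a y (+) h y b) ->
    walk_sum h (phi z) W -> exists c : G -> bool,
      forall u v, adj u v -> c u = c v -> h (phi u) (phi v).
  move=> h_sym h_sq hW.
  apply: (cocycle_coloring (g := fun u v => h (phi u) (phi v))
    G_connected pi1_cyclic _ _ CP Cl Co); last by rewrite walk_sum_map.
  - by move=> u v; apply: h_sym.
  - by move=> a x y b *; apply: h_sq; apply: phi_hom.
case: alt => [[v vW]|[n [d [n_le S]]]].
  have [c cP] := color _ (corner_sym e0_adj v) (@corner_cocycle H e0 e0_adj v) vW.
  exact: (chromatic_corner r_ge2 phi_hom cP).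
have k_sym := square_class_symm e0_adj; have k_adj := square_class_adj e0_adj.
have [c cP] := color _ k_sym (square_class_cocycle e0_adj) e0W.
apply: (chromatic_near_cycle r_ge2 phi_hom H_free n_le _ cP).
have [on nm per dP inj] := S.
apply: (confinement H_free k_sym k_adj _ on n_le nm per dP inj).
  move=> a b b' a' h1 h2 h3 h4 n1 n2.
  by rewrite (square_class_square e0 h1 h2 h3 h4).
move=> P P0 Psym Pstep a b kab.
apply: (square_step_ind P0 Psym Pstep).
(* The induction starts at the edge from [d 0] to [d 1] instead of [e0]; both generate the same
   class. *)
apply: connect_trans kab; rewrite (@square_class_sym H); exact: (dP 0).
Qed.
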